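(* Let $d\in\mathbb{N}$. There is a constant $C>0$ depending only on $d$ such that for every $f\in H^2_{\mathrm{mix}}(\mathbb{R}^d)$, $$ \sup_{\mathbf{k}\in\mathbb{Z}^d}\prod_{i=1}^d(1+|k_i|)^2\Big(\sum_{\mathbf{m}\in\mathbb{Z}^d}\big|[\mathcal{R}f(\cdot-\mathbf{m})]^\wedge(\mathbf{k})\big|^2\Big)^{1/2}\le C\|f\|_{H^2_{\mathrm{mix}}(\mathbb{R}^d)}. $$
   Context: $H^2_{\mathrm{mix}}(\mathbb{R}^d)$ is the space of real functions $f$ on $\mathbb{R}^d$ such that for every $e\subseteq\{1,\dots,d\}$ the weak derivative $\big(\prod_{i\in e}\partial^2/\partial x_i^2\big)f$ lies in $L_2(\mathbb{R}^d)$, normed by the square root of the sum of the squared $L_2$-norms of these derivatives. For $\mathbf{m}\in\mathbb{Z}^d$, $f(\cdot-\mathbf{m})$ denotes the function $\mathbf{x}\mapsto f(\mathbf{x}-\mathbf{m})$ restricted to $[0,1]^d$, and $\mathcal{R}$ is the tent transform $\mathcal{R}g(y_1,\dots,y_d)=g(|2y_1-1|,\dots,|2y_d-1|)$, a function on $\mathbb{T}^d\cong[0,1)^d$. For $g\in L_1(\mathbb{T}^d)$, $\hat g(\mathbf{k})=\int_{[0,1]^d}g(\mathbf{x})e^{-2\pi i\mathbf{k}^\top\mathbf{x}}\,d\mathbf{x}$. *)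

(* Defs.v *)
From HB Require Import structures.
From mathcomp Require Import all_boot all_order all_algebra.
From mathcomp Require Import all_classical all_reals all_analysis.
Set Implicit Arguments. Unset Strict Implicit. Unset Printing Implicit Defensive.
Import Order.TTheory GRing.Theory Num.Theory.
Import numFieldNormedType.Exports.
Local Open Scope classical_set_scope.
Local Open Scope ring_scope.

Section Defs.
Variables (R : realType) (d : nat).
Implicit Types (x : 'rV[R]_d) (f g phi : 'rV[R]_d -> R).

Definition setc x (k : nat) (t : R) : 'rV[R]_d :=
  \row_(j < d) (if (j : nat) == k then t else x ord0 j).

Fixpoint iint (D : set R) (k : nat) (F : 'rV[R]_d -> \bar R) x : \bar R :=
  match k with
  | 0 => F x
  | k'.+1 => (\int[lebesgue_measure]_(t in D) iint D k' F (setc x k' t))%E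
  end.

Definition integral_d (D : set R) (F : 'rV[R]_d -> \bar R) : \bar R :=
  iint D d F 0.

Definition borel_rV : set (set 'rV[R]_d) := <<s [set U | open U] >>.
Definition measurable_d f : Prop :=
  forall B : set R, measurable B -> borel_rV (f @^-1` B).

Definition L2sq f : \bar R := integral_d setT (fun x => ((f x) ^+ 2)%:E).

Definition pderiv (i : 'I_d) f : 'rV[R]_d -> R :=
  fun x => derive1 (fun t => f (setc x i t)) (x ord0 i).

Fixpoint pD (s : seq 'I_d) f : 'rV[R]_d -> R :=
  match s with
  | [::] => f
  | i :: s' => pderiv i (pD s' f)
  end.

Definition smooth phi : Prop :=
  forall s : seq 'I_d, continuous (pD s phi) /\
    forall (i : 'I_d) x, derivable (fun t => pD s phi (setc x i t)) (x ord0 i) 1.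

Definition test_fun phi : Prop :=
  smooth phi /\ compact (closure [set x | phi x != 0]).

(* the mixed derivative prod_{i in e} d^2/dx_i^2 *)
Definition mixseq (e : {set 'I_d}) : seq 'I_d := flatten [seq [:: i; i] | i <- enum e].

(* g is the weak derivative (prod_{i in e} d^2/dx_i^2) f ;
   the sign (-1)^(2|e|) = 1 *)
Definition weak_mixD (e : {set 'I_d}) f g : Prop :=
  forall phi, test_fun phi ->
    integral_d setT (fun x => (f x * pD (mixseq e) phi x)%:E) =
    integral_d setT (fun x => (g x * phi x)%:E).

Definition H2mix_witness f (G : {set 'I_d} -> 'rV[R]_d -> R) : Prop :=
  measurable_d f /\
  forall e, [/\ measurable_d (G e), L2sq (G e) < +oo & weak_mixD e f (G e)]%E.

Definition H2mix_norm (G : {set 'I_d} -> 'rV[R]_d -> R) : R :=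
  Num.sqrt (\sum_(e : {set 'I_d}) fine (L2sq (G e))).

Definition kdot (k : 'rV[int]_d) x : R := \sum_(i < d) (k ord0 i)%:~R * x ord0 i.
Definition fourier_re (g : 'rV[R]_d -> R) (k : 'rV[int]_d) : \bar R :=
  integral_d `[0, 1] (fun x => (g x * cos (2 * pi * kdot k x))%:E).
Definition fourier_im (g : 'rV[R]_d -> R) (k : 'rV[int]_d) : \bar R :=
  integral_d `[0, 1] (fun x => (- (g x * sin (2 * pi * kdot k x)))%:E).
Definition fourier_abs2 g k : \bar R :=
  (fourier_re g k ^+ 2 + fourier_im g k ^+ 2)%E.

Definition tent_shift f (m : 'rV[int]_d) : 'rV[R]_d -> R :=
  fun y => f (\row_(i < d) (`|2 * y ord0 i - 1| - (m ord0 i)%:~R)).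

Definition weight (k : 'rV[int]_d) : R := \prod_(i < d) (1 + (`|k ord0 i|%:~R)) ^+ 2.

Definition lhs_sup f : \bar R :=
  ereal_sup [set ((weight k)%:E * sqrte (\esum_(m in [set: 'rV[int]_d]) fourier_abs2 (tent_shift f m) k))%E
            | k in [set: 'rV[int]_d]].

End Defs.

(* Main.v *)
(** The function [f] is not assumed locally integrable and all integrals are
    iterated, so one first shows that [f] equals the square integrable function
    [g = G set0] almost everywhere: testing against a countable family of
    products of cut-offs, this reduces slice by slice to the line.

    The tent transform is symmetric under each reflection [y_i |-> 1 - y_i], hence
    the Fourier coefficient of the [m]-th translate at [k] is, up to sign, the
    integral of [g] against [prod_i cos (pi k_i (x_i + m_i))] over the open unit
    cube [Q_m] with corner [-m].  In one variable,
    [(1 + |k|)^2 cos (pi k v) = a''(v) + q(v)] where [a] and [q] are bounded by [4]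
    whatever [k] is, and [a] vanishes to second order at [0] and [1]:
    [a] is a multiple of [cos (pi j v) - cos (pi k v)] with [j] the parity of [k].
    Multiplied by cut-offs [exp (- 1 / (s v)) exp (- 1 / (s (1 - v)))], the function
    [a] gives test functions whose second derivatives stay bounded as [s] grows.
    Expanding the product over the subsets [e] of coordinates and moving the
    derivatives indexed by [e] onto [f] bounds the weighted coefficient by
    [4^d sum_e int_(Q_m) |G e|]; Cauchy-Schwarz on the cubes, which are disjoint and
    of measure one, and summation over [m] give the constant [8^d]. *)

Require Import Defs.
From HB Require Import structures.
From mathcomp Require Import all_boot all_order all_algebra.
From mathcomp Require Import all_classical all_reals all_analysis.
From mathcomp Require Import measurable_realfun ring lra.
Import Order.TTheory GRing.Theory Num.Theory.
Import numFieldNormedType.Exports HBNNSimple.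
Local Open Scope classical_set_scope.
Local Open Scope ring_scope.

Set Implicit Arguments. Unset Strict Implicit. Unset Printing Implicit Defensive.

(** * The Borel sigma-algebra of row vectors *)

(** Two kinds of bounds are kept apart. The cut-off functions themselves are bounded by [4] at every
    frequency and every scale, and only these bounds enter the constant: [4 ^+ d] from the factors,
    [2 ^+ d] from the number of subsets [e]. The bounds on their second derivatives grow with the
    frequency, but serve only as dominating functions when the scale tends to infinity. Uniformity
    in the scale is a matter of homogeneity: [s ^+ j] times the [j]-th derivative of exp(-1/y) at
    [y = s * v] is a bounded function of [s * v] divided by [v ^+ j]. Near an end point the division
    is paid for by the double zero of [a]; the comparison frequency has the parity of [k] so that
    this zero is present at both ends.

    The weak derivatives are given by identities between iterated integrals with values in the
    extended reals, where [oo - oo] is [-oo]. A finite value therefore forces integrability, one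
    variable at a time, and this is how integrability of the slices of [f] is recovered from that of
    [g] times a test function. *)

Notation rVb R d := (g_sigma_algebraType [set U : set 'rV[R]_d | open U]).

Section BorelRowVectors.
Context {R : realType} {d : nat}.
Implicit Types x : 'rV[R]_d.

(** Rational centres and radii form a countable base, which is what lets coordinatewise
    measurability imply Borel measurability of maps into row vectors. *)
Lemma rV_open_bigcup_rat (U : set 'rV[R]_d) : open U ->
  U = \bigcup_(qn : 'rV[rat]_d * nat)
        [set x | ball (map_mx ratr qn.1 : 'rV[R]_d) qn.2.+1%:R^-1 x /\
                 ball (map_mx ratr qn.1 : 'rV[R]_d) qn.2.+1%:R^-1 `<=` U].
Proof.
move=> oU; apply/seteqP; split=> [x Ux|x [qn _ [bx]]]; last exact.
have /nbhs_ballP[e /= e0 eU] : nbhs x U by exact: open_nbhs_nbhs.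
have [n ne] : exists n : nat, n.+1%:R^-1 < e / 2.
  have e2 : 0 < (e / 2)^-1 by rewrite invr_gt0 divr_gt0.
  exists (Num.trunc (e / 2)^-1); rewrite invf_plt ?posrE ?divr_gt0//.
  exact: truncnS_gt.
have q_ex (i : 'I_d) : exists q : rat,
    x ord0 i - n.+1%:R^-1 < ratr q < x ord0 i + n.+1%:R^-1.
  have : x ord0 i - n.+1%:R^-1 < x ord0 i + n.+1%:R^-1.
    by rewrite ltrD2l gtrN// invr_gt0.
  by move=> /rat_in_itvoo[q]; rewrite in_itv/= => qi; exists q.
have [q qE] := boolp.choice q_ex.
have bxq : ball (map_mx ratr (\row_i q i) : 'rV[R]_d) n.+1%:R^-1 x.
  split; first by rewrite invr_gt0.
  move=> i j; rewrite !mxE (ord1 i) /ball/= ltr_distlC.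
  by have /andP[q1 q2] := qE j; move: q1 q2; move: (n.+1%:R^-1) => ee q1 q2; apply/andP; split; lra.
exists (\row_i q i, n) => //=; split=> // y qy; apply: eU.
have := ball_triangle (ball_sym bxq) qy; apply: le_ball.
by rewrite [leRHS](splitr e) lerD// ltW.
Qed.

(** The ball of a row vector carries [0 < e] as a conjunct while the intersection over coordinates
    does not; the hypothesis reconciles them when [d = 0]. *)
Lemma preimage_ball_rV (Y : Type) (c : 'rV[R]_d) (e : R) (h : Y -> 'rV[R]_d) :
  0 < e -> h @^-1` ball c e =
    \bigcap_(i in [set: 'I_d]) ((fun y : Y => h y ord0 i) @^-1` ball (c ord0 i) e).
Proof.
move=> e0; apply/seteqP; split=> [y [_ hy] i _|y hy]; first exact: hy.
by split=> // i j; rewrite (ord1 i); exact: hy.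
Qed.

Lemma measurable_fun_rV d' (Y : measurableType d') (h : Y -> 'rV[R]_d) :
  (forall i, measurable_fun setT (fun y => h y ord0 i)) ->
  measurable_fun setT (h : Y -> rVb R d).
Proof.
move=> mh; apply: (@measurability _ _ Y (rVb R d) setT h
  [set U : set (rVb R d) | open (U : set 'rV[R]_d)]) => //.
move=> _ [U /= oU <-]; rewrite setTI (rV_open_bigcup_rat oU) preimage_bigcup.
apply: countable_bigcupT_measurable => // -[q n] /=.
have [bU|bU] := pselect (ball (map_mx ratr q : 'rV[R]_d) n.+1%:R^-1 `<=` U);
  last by rewrite (_ : _ @^-1` _ = set0) ?measurable0// -subset0 => x [].
rewrite (_ : _ @^-1` _ = h @^-1` ball (map_mx ratr q : 'rV[R]_d) n.+1%:R^-1);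
  last by apply/seteqP; split=> [x []|].
rewrite preimage_ball_rV ?invr_gt0//.
apply: fin_bigcap_measurable => // i _; rewrite -[X in measurable X]setTI.
by apply: mh => //; exact: measurable_ball.
Qed.

Lemma open_measurable_rV (U : set 'rV[R]_d) : open U -> measurable (U : set (rVb R d)).
Proof. by move=> oU; exact: sub_sigma_algebra. Qed.

Lemma continuous_measurable_rV (f : 'rV[R]_d -> R) : continuous f ->
  measurable_fun setT (f : rVb R d -> R).
Proof.
move=> cf; apply: (measurability (@RGenOpens.G R)) => [|_ [_ [a [b ->]] <-]].
  exact: RGenOpens.measurableE.
rewrite setTI; apply: open_measurable_rV; apply: open_comp; last exact: itv_open.
by move=> x _; exact: cf.
Qed.

Lemma measurable_neq_rV (f g : 'rV[R]_d -> R) :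
  measurable_fun setT (f : rVb R d -> R) -> measurable_fun setT (g : rVb R d -> R) ->
  measurable [set y : rVb R d | f y != g y].
Proof.
move=> mf mg.
have mfg : measurable_fun setT (fun y : rVb R d => f y - g y) by exact: measurable_funB.
rewrite (_ : [set y | _] = ~` ((fun y : rVb R d => f y - g y) @^-1` [set 0])).
  by apply: measurableC; rewrite -[X in measurable X]setTI; exact: mfg.
by apply/seteqP; split=> y /=; rewrite -subr_eq0 => /eqP.
Qed.

Lemma measurable_coord (i : 'I_d) :
  measurable_fun setT (fun x : rVb R d => (x : 'rV[R]_d) ord0 i).
Proof. by apply: continuous_measurable_rV => x; exact: coord_continuous. Qed.

Lemma measurable_setc (k : nat) :
  measurable_fun setT (fun z : rVb R d * R => setc (z.1 : 'rV[R]_d) k z.2 : rVb R d).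
Proof.
apply: measurable_fun_rV => i.
rewrite (_ : (fun _ => _) = fun z : rVb R d * R =>
   if (i : nat) == k then z.2 else (z.1 : 'rV[R]_d) ord0 i); last first.
  by apply/funext => z; rewrite mxE.
case: ((i : nat) == k); first exact: measurable_snd.
by apply: (measurableT_comp (measurable_coord i)); exact: measurable_fst.
Qed.

Lemma measurable_setc_r (k : nat) (x : 'rV[R]_d) :
  measurable_fun setT (fun t : R => setc x k t : rVb R d).
Proof.
apply: measurable_fun_rV => i.
rewrite (_ : (fun _ => _) = fun t : R => if (i : nat) == k then t else x ord0 i);
  last by apply/funext => t; rewrite mxE.
by case: ((i : nat) == k).
Qed.

Lemma measurable_dP (f : 'rV[R]_d -> R) :
  measurable_d f <-> measurable_fun setT (f : rVb R d -> R).
Proof.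
split=> [mf _ B mB|mf B mB]; first by rewrite setTI; exact: mf.
by have := mf measurableT B mB; rewrite setTI.
Qed.

End BorelRowVectors.

(** * Iterated integrals and the measures they define *)

(** The domain may vary with the coordinate because the cubes met below are products of different
    intervals. The outermost variable is the coordinate [k - 1]; coordinates from [k] on are read
    off [x]. *)
Fixpoint giint {R : realType} {d : nat} (D : nat -> set R) (k : nat)
    (F : 'rV[R]_d -> \bar R) (x : 'rV[R]_d) : \bar R :=
  match k with
  | 0 => F x
  | k'.+1 => (\int[lebesgue_measure]_(t in D k') giint D k' F (setc x k' t))%E
  end.

Lemma iint_giint {R : realType} {d : nat} (D : set R) k (F : 'rV[R]_d -> \bar R) x :
  iint D k F x = giint (fun=> D) k F x.
Proof. by elim: k x => //= k IH x; apply: eq_integral => t _; rewrite IH. Qed.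

Lemma setc_eq {R : realType} {d : nat} (x : 'rV[R]_d) (j : 'I_d) (t : R) :
  setc x j t ord0 j = t.
Proof. by rewrite mxE eqxx. Qed.

Lemma setc_neq {R : realType} {d : nat} (x : 'rV[R]_d) (j : 'I_d) k (t : R) :
  (j : nat) != k -> setc x k t ord0 j = x ord0 j.
Proof. by move=> /negPf jk; rewrite mxE jk. Qed.

Section IteratedIntegral.
Context {R : realType} {d : nat} (D : nat -> set R).
Hypothesis mD : forall k, measurable (D k).
Local Notation X := (rVb R d).
Local Notation leb := (@lebesgue_measure R).
Implicit Types (F : 'rV[R]_d -> \bar R) (x : 'rV[R]_d).
Local Open Scope ereal_scope.

(** Within a [k]-fold integral the coordinates from [k] on are constants; this is what lets a factor
    depending on them leave the integral. *)
Lemma giint_ext k F F' x :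
  (forall y : 'rV[R]_d, (forall j : 'I_d, (k <= j)%N -> y ord0 j = x ord0 j) ->
     (forall j : 'I_d, (j < k)%N -> D j (y ord0 j)) -> F y = F' y) ->
  giint D k F x = giint D k F' x.
Proof.
elim: k x => [|k IH] x FF' /=; first exact: FF'.
apply: eq_integral => t; rewrite inE => Dt; apply: IH => y yj yD.
apply: FF' => j kj.
  by rewrite yj ?(ltnW kj)// setc_neq// neq_ltn kj orbT.
move: kj; rewrite ltnS leq_eqVlt => /orP[/eqP jk|jk]; last exact: yD.
by rewrite yj ?jk// mxE jk eqxx.
Qed.

Lemma eq_giint k F F' x : F =1 F' -> giint D k F x = giint D k F' x.
Proof. by move=> FF'; apply: giint_ext => y _ _. Qed.

Lemma giint_ge0 k F x : (forall y, 0 <= F y) -> 0 <= giint D k F x.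
Proof.
move=> F0; elim: k x => //= k IH x.
by apply: integral_ge0 => t _; exact: IH.
Qed.

(** Tonelli's measurability of sections, applied to the positive and negative parts of the extension
    by zero. *)
Lemma measurable_section_integral (A : set R) (H : X * R -> \bar R) :
  measurable A -> measurable_fun setT H ->
  measurable_fun setT (fun x : X => \int[leb]_(t in A) H (x, t)).
Proof.
move=> mA mH.
have mHA : measurable_fun setT (H \_ (setT `*` A)).
  apply/(measurable_restrictT _ (measurableX measurableT mA)).
  exact: measurable_funTS.
rewrite (_ : (fun _ => _) = (fun x : X =>
    \int[leb]_t (H \_ (setT `*` A))^\+ (x, t) - \int[leb]_t (H \_ (setT `*` A))^\- (x, t))).
  apply: emeasurable_funB.
    apply: (@measurable_fun_fubini_tonelli_F _ _ X (measurableTypeR R) R leb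
      ((H \_ (setT `*` A))^\+)) => //; exact: measurable_funepos.
  apply: (@measurable_fun_fubini_tonelli_F _ _ X (measurableTypeR R) R leb
      ((H \_ (setT `*` A))^\-)) => //; exact: measurable_funeneg.
apply/funext => x; rewrite integral_mkcond integralE.
by congr (_ - _); apply: eq_integral => t _; rewrite ?funeposE ?funenegE !patchE/= in_setX
  in_setT.
Qed.

Lemma measurable_giint k F : measurable_fun setT (F : X -> \bar R) ->
  measurable_fun setT (giint D k F : X -> \bar R).
Proof.
move=> mF; elim: k => //= k IH.
exact: (measurable_section_integral (mD k) (measurableT_comp IH (measurable_setc k))).
Qed.

Lemma measurable_giint_setc k F x : measurable_fun setT (F : X -> \bar R) ->
  measurable_fun setT (fun t : R => giint D k F (setc x k t)).
Proof.
by move=> mF; exact: (measurableT_comp (measurable_giint k mF) (measurable_setc_r k x)).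
Qed.

Lemma measurable_giint_setcS (A : set R) k F x : measurable_fun setT (F : X -> \bar R) ->
  measurable_fun A (fun t : R => giint D k F (setc x k t)).
Proof. by move=> mF; apply: measurable_funTS; exact: measurable_giint_setc. Qed.

Lemma giint_nneseries k (F : nat -> 'rV[R]_d -> \bar R) x :
  (forall n, measurable_fun setT (F n : X -> \bar R)) -> (forall n y, 0 <= F n y) ->
  giint D k (fun y => \sum_(0 <= n <oo) F n y) x = \sum_(0 <= n <oo) giint D k (F n) x.
Proof.
move=> mF F0; elim: k x => //= k IH x; under eq_integral do rewrite IH.
apply: (@integral_nneseries _ _ _ leb _ (mD k)
  (fun n t => giint D k (F n) (setc x k t))) => // [n|n t _]; last exact: giint_ge0.
exact: measurable_giint_setcS.
Qed.

Lemma ge0_giintD k F F' x :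
  measurable_fun setT (F : X -> \bar R) -> measurable_fun setT (F' : X -> \bar R) ->
  (forall y, 0 <= F y) -> (forall y, 0 <= F' y) ->
  giint D k (fun y => F y + F' y) x = giint D k F x + giint D k F' x.
Proof.
move=> mF mF' F0 F'0; elim: k x => //= k IH x; under eq_integral do rewrite IH.
apply: (@ge0_integralD _ _ _ leb _ (mD k)
  (fun t => giint D k F (setc x k t)) (fun t => giint D k F' (setc x k t))) => // [t _||t _|];
  [exact: giint_ge0| |exact: giint_ge0|];
  exact: measurable_giint_setcS.
Qed.

(* Holds without integrability because [oo - oo] is still [-oo] after scaling. *)
Lemma integral_nnegZl (A : set R) (h : R -> \bar R) (c : R) : measurable A ->
  measurable_fun A h -> (0 <= c)%R ->
  \int[leb]_(t in A) (c%:E * h t) = c%:E * \int[leb]_(t in A) h t.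
Proof.
move=> mA mh c0; rewrite integralE [in RHS]integralE.
have -> : \int[leb]_(t in A) (fun t => c%:E * h t)^\+ t = c%:E * \int[leb]_(t in A) h^\+ t.
  rewrite -ge0_integralZl_EFin//; last exact: measurable_funepos.
  by apply: eq_integral => t _; rewrite ge0_funeposM.
have -> : \int[leb]_(t in A) (fun t => c%:E * h t)^\- t = c%:E * \int[leb]_(t in A) h^\- t.
  rewrite -ge0_integralZl_EFin//; last exact: measurable_funeneg.
  by apply: eq_integral => t _; rewrite ge0_funenegM.
move: c0; rewrite le_eqVlt => /orP[/eqP <-|c0]; first by rewrite !mul0e sube0.
have p0 : 0 <= \int[leb]_(t in A) h^\+ t by exact: integral_ge0.
have n0 : 0 <= \int[leb]_(t in A) h^\- t by exact: integral_ge0.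
move: p0 n0; case: (integral _ _ _) => [a| |]//; case: (integral _ _ _) => [b| |]// _ _.
- by rewrite -!EFinM -!EFinB mulrBr.
- by rewrite gt0_muley ?lte_fin//= gt0_muleNy.
- by rewrite gt0_muley ?lte_fin//= gt0_muley.
- by rewrite gt0_muley ?lte_fin//= gt0_muleNy.
Qed.

(** Serves to take a cut-off out of an iterated integral of [f], about which only measurability is
    known at that stage. *)
Lemma giint_nnegZl k F (c : R) x : measurable_fun setT (F : X -> \bar R) -> (0 <= c)%R ->
  giint D k (fun y => c%:E * F y) x = c%:E * giint D k F x.
Proof.
move=> mF c0; elim: k x => //= k IH x; under eq_integral do rewrite IH.
rewrite (integral_nnegZl (mD k))//.
exact: measurable_giint_setcS.
Qed.

Lemma le_giint k F F' x :
  measurable_fun setT (F : X -> \bar R) -> measurable_fun setT (F' : X -> \bar R) ->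
  (forall y, 0 <= F y) -> (forall y, F y <= F' y) -> giint D k F x <= giint D k F' x.
Proof.
move=> mF mF' F0 FF'; elim: k x => //= k IH x.
apply: (@ge0_le_integral _ _ _ leb _ (mD k)) => // [t _||].
- exact: giint_ge0.
- exact: measurable_giint_setcS.
- exact: measurable_giint_setcS.
Qed.

Lemma giint_limn k (F : nat -> 'rV[R]_d -> \bar R) x :
  (forall n, measurable_fun setT (F n : X -> \bar R)) -> (forall n y, 0 <= F n y) ->
  (forall y, nondecreasing_seq (F ^~ y)) ->
  giint D k (fun y => limn (F ^~ y)) x = limn (fun n => giint D k (F n) x).
Proof.
move=> mF F0 nd; elim: k x => //= k IH x; under eq_integral do rewrite IH.
apply: (@monotone_convergence _ _ _ leb _ (mD k)
  (fun n t => giint D k (F n) (setc x k t))) => // [n|n t _|t _ m n mn].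
- exact: measurable_giint_setcS.
- exact: giint_ge0.
- by apply: le_giint => // y; exact: nd.
Qed.

Lemma measurable_indic_EFin (A : set X) : measurable A ->
  measurable_fun setT (fun y : X => (\1_A y)%:E : \bar R).
Proof. by move=> mA; apply/measurable_EFinP; exact: measurable_indic. Qed.

(* The measurability proof is an argument only to let the measure structure be inferred. *)
Definition gmeas (_ : forall k, measurable (D k)) (A : set X) : \bar R :=
  giint D d (fun y => (\1_A y)%:E) 0.

Let gmeas0 : gmeas mD set0 = 0.
Proof.
rewrite /gmeas (@eq_giint _ _ (cst 0)); last by move=> y; rewrite indic0.
rewrite (_ : cst 0 = fun y : 'rV[R]_d => 0%:E * (0 : \bar R)).
  by rewrite giint_nnegZl// mul0e.
by apply/funext => y; rewrite mul0e.
Qed.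

Let gmeas_ge0 A : 0 <= gmeas mD A.
Proof. by apply: giint_ge0 => y; rewrite lee_fin. Qed.

Let gmeas_sigma_additive : semi_sigma_additive (gmeas mD).
Proof.
move=> A mA tA mUA; rewrite /gmeas.
rewrite (@eq_giint _ _ (fun y => \sum_(0 <= n <oo) (\1_(A n) y)%:E)); last first.
  move=> y; exact: indic_bigcup.
rewrite giint_nneseries//.
  by apply: is_cvg_nneseries => n _ _; exact: gmeas_ge0.
by move=> n; exact: measurable_indic_EFin.
Qed.

HB.instance Definition _ := isMeasure.Build _ X R (gmeas mD) gmeas0 gmeas_ge0
  gmeas_sigma_additive.

(** Both sides are continuous along increasing sequences and agree on indicator functions by
    definition of [gmeas], so simple functions suffice. *)
Lemma ge0_integral_gmeas F : measurable_fun setT (F : X -> \bar R) ->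
  (forall y, 0 <= F y) -> \int[gmeas mD]_y F y = giint D d F 0.
Proof.
move=> mF F0.
pose f_ n : {nnsfun X >-> R} := nnsfun_approx measurableT mF n.
have f_F y : limn (fun n => (f_ n y)%:E) = F y.
  by apply/cvg_lim => //; exact: (cvg_nnsfun_approx measurableT mF (fun y _ => F0 y)).
have nd y : nondecreasing_seq (fun n => (f_ n y)%:E).
  move=> m n mn; rewrite lee_fin.
  by have /lefP := nd_nnsfun_approx measurableT mF mn; exact.
have mf n : measurable_fun setT (fun y : X => (f_ n y)%:E).
  by apply/measurable_EFinP; exact: measurable_funTS.
have f0 n y : 0 <= (f_ n y)%:E by rewrite lee_fin.
transitivity (limn (fun n => giint D d (fun y => (f_ n y)%:E) 0)); last first.
  rewrite -giint_limn//; exact: eq_giint.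
transitivity (limn (fun n => \int[gmeas mD]_y (f_ n y)%:E)).
  by rewrite -monotone_convergence//; apply: eq_integral => y _; rewrite f_F.
congr (limn _); apply/funext => n; move: (f_ n) => g {f_ f_F nd mf f0}.
have fg : finite_set (range g) by [].
(* The values of [g] are non-negative, but the induction below runs over an arbitrary list of reals;
   the absolute value keeps all its terms non-negative. *)
have gE : (fun y => (g y)%:E) =
    fun y => \sum_(r <- finmap.enum_fset (fset_set (range g)))
      (`|r|%:E * (\1_(g @^-1` [set r]) y)%:E).
  apply/funext => y; rewrite [in LHS](fimfunE g) fsbig_finite// -sumEFin.
  rewrite big_seq [RHS]big_seq; apply: eq_bigr => r.
  rewrite in_fset_set// inE/= => -[z _ <-]; rewrite ger0_norm//.
rewrite gE; elim: (finmap.enum_fset _) => [|r s IH] {gE}.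
  under eq_integral do rewrite big_nil.
  under eq_giint do rewrite big_nil.
  by rewrite integral0 -(gmeas0); apply: eq_giint => y; rewrite indic0.
have mg (q : R) : measurable (g @^-1` [set q] : set X).
  exact: measurable_sfunP.
have m1 := measurable_indic_EFin (mg r).
have mr := measurable_funeM `|r|%:E m1.
have ms : measurable_fun setT (fun y : X =>
    \sum_(r <- s) (`|r|%:E * (\1_(g @^-1` [set r]) y)%:E)).
  apply: emeasurable_sum => r'; apply: measurable_funeM.
  exact: (measurable_indic_EFin (mg r')).
have r0 y : 0 <= `|r|%:E * (\1_(g @^-1` [set r]) y)%:E.
  by rewrite -EFinM lee_fin mulr_ge0.
have s0 y : 0 <= \sum_(r <- s) (`|r|%:E * (\1_(g @^-1` [set r]) y)%:E).
  by apply: sume_ge0 => r' _; rewrite -EFinM lee_fin mulr_ge0.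
under eq_integral do rewrite big_cons.
under eq_giint do rewrite big_cons.
rewrite ge0_integralD// ge0_giintD// IH giint_nnegZl// ge0_integralZl//.
by congr (_ * _ + _); rewrite integral_indic// setIT.
Qed.

End IteratedIntegral.

Lemma giint_base {R : realType} {d : nat} (D : nat -> set R) k
    (F : 'rV[R]_d -> \bar R) (x x' : 'rV[R]_d) :
  (forall j : 'I_d, (k <= j)%N -> x ord0 j = x' ord0 j) -> giint D k F x = giint D k F x'.
Proof.
elim: k x x' => [|k IH] x x' xx' /=.
  by congr F; apply/rowP => j; exact: xx'.
apply: eq_integral => t _; apply: IH => j; rewrite leq_eqVlt => /orP[/eqP kj|kj].
  by rewrite !mxE kj eqxx.
by rewrite !setc_neq ?xx'// neq_ltn kj orbT.
Qed.

Lemma giint0_setT {R : realType} {d : nat} k x :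
  giint (fun=> setT) k (cst 0 : 'rV[R]_d -> \bar R) x = 0%E.
Proof.
elim: k x => //= k IH x; under eq_integral do rewrite IH.
exact: integral0.
Qed.

Lemma ae_imply {R : realType} (P Q : R -> Prop) : (forall t, P t -> Q t) ->
  {ae @lebesgue_measure R, forall t, P t} -> {ae @lebesgue_measure R, forall t, Q t}.
Proof. by move=> PQ; apply: negligibleS => t /=; apply: contra_not; exact: PQ. Qed.

(** * Fubini for iterated integrals: null sets, signed integrands, boxes *)

Section IteratedFubini.
Context {R : realType} {d : nat} (D : nat -> set R).
Hypothesis mD : forall k, measurable (D k).
Local Notation X := (rVb R d).
Local Notation leb := (@lebesgue_measure R).
Implicit Types (F : 'rV[R]_d -> \bar R) (x : 'rV[R]_d).
Local Open Scope ereal_scope.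

Lemma ge0_giint_eq0_ae k F x : measurable_fun setT (F : X -> \bar R) ->
  (forall y, 0 <= F y) -> giint D k.+1 F x = 0 ->
  {ae leb, forall t, D k t -> giint D k F (setc x k t) = 0}.
Proof.
move=> mF F0 FE.
have /(proj1 (ae_eq_integral_abs leb (mD k) (measurable_giint_setcS mD k x mF))) :
  \int[leb]_(t in D k) `|giint D k F (setc x k t)| = 0; last by [].
rewrite -[RHS]FE/=; apply: eq_integral => t _.
by rewrite gee0_abs// giint_ge0.
Qed.

(** A null set has null slices for almost every value of the outermost variable, so the inner
    integrals agree almost everywhere, whether finite or not. *)
Lemma giint_ae_eq k (E : set X) F F' x : measurable E ->
  measurable_fun setT (F : X -> \bar R) -> measurable_fun setT (F' : X -> \bar R) ->
  (forall y, ~ E y -> F y = F' y) ->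
  giint D k (fun y => (\1_E y)%:E) x = 0 -> giint D k F x = giint D k F' x.
Proof.
move=> mE mF mF' FF'; elim: k x => [x /=|k IH x].
  move=> /eqP; rewrite eqe indicE; case: (boolP (x \in E)) => [_|xE _].
    by rewrite oner_eq0.
  by apply: FF' => Ex; move/negP: xE; apply; rewrite inE.
move=> /(ge0_giint_eq0_ae (measurable_indic_EFin mE)) => /(_ _)E0.
apply: (@ae_eq_integral _ (measurableTypeR R) R leb (D k) _ _ (mD k)).
- exact: measurable_giint_setcS.
- exact: measurable_giint_setcS.
- have := E0 (fun y => ltac:(by rewrite lee_fin)).
  by apply: ae_imply => t Ht Dt; apply: IH; exact: Ht.
Qed.

(** Absolute integrability excludes [oo - oo] in the inner integrals: they are finite for almost
    every outer variable, and linearity then passes outward. *)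
Lemma giintB k F x : measurable_fun setT (F : X -> \bar R) ->
  giint D k (abse \o F) x < +oo ->
  giint D k F x = giint D k F^\+ x - giint D k F^\- x.
Proof.
move=> mF; elim: k x => [x /= _|k IH x /= Foo].
  by rewrite [in LHS](funeposneg F).
have mF1 : measurable_fun setT (abse \o F : X -> \bar R) by exact: measurableT_comp.
have mFp : measurable_fun setT (F^\+ : X -> \bar R) by exact: measurable_funepos.
have mFn : measurable_fun setT (F^\- : X -> \bar R) by exact: measurable_funeneg.
have iF : leb.-integrable (D k) (fun t => giint D k (abse \o F) (setc x k t)).
  apply/integrableP; split; first exact: measurable_giint_setcS.
  apply: le_lt_trans Foo; rewrite le_eqVlt; apply/orP; left; apply/eqP.
  by apply: eq_integral => t _; apply: gee0_abs; apply: giint_ge0 => y; exact: abse_ge0.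
have ip : leb.-integrable (D k) (fun t => giint D k F^\+ (setc x k t)).
  apply: (@le_integrable _ (measurableTypeR R) R leb _ (mD k) _
    (fun t => giint D k (abse \o F) (setc x k t))) => //; first exact: measurable_giint_setcS.
  move=> t _; rewrite !gee0_abs ?giint_ge0//; [|by move=> y; exact: abse_ge0].
  apply: le_giint => // y.
  by rewrite funeposE ge_max lee_abs abse_ge0.
have in_ : leb.-integrable (D k) (fun t => giint D k F^\- (setc x k t)).
  apply: (@le_integrable _ (measurableTypeR R) R leb _ (mD k) _
    (fun t => giint D k (abse \o F) (setc x k t))) => //; first exact: measurable_giint_setcS.
  move=> t _; rewrite !gee0_abs ?giint_ge0//; [|by move=> y; exact: abse_ge0].
  apply: le_giint => // y.
  by rewrite funenegE ge_max/= -abseN lee_abs abse_ge0.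
transitivity (\int[leb]_(t in D k)
  (giint D k F^\+ (setc x k t) - giint D k F^\- (setc x k t)));
  last exact: (@integralB _ (measurableTypeR R) R leb _ (mD k) _ _ ip in_).
apply: (@ae_eq_integral _ (measurableTypeR R) R leb (D k) _ _ (mD k)).
- exact: measurable_giint_setcS.
- by apply: emeasurable_funB; exact: measurable_giint_setcS.
- have := @integrable_ae _ (measurableTypeR R) R leb _ (mD k) _ iF.
  apply: ae_imply => t Ht Dt; apply: IH.
  have := Ht Dt; rewrite ge0_fin_numE//; apply: giint_ge0 => y; exact: abse_ge0.
Qed.

(** The bridge from iterated integrals to integrals against one measure, where dominated convergence
    is available. *)
Lemma integral_gmeas F : (gmeas mD).-integrable setT (F : X -> \bar R) ->
  \int[gmeas mD]_y F y = giint D d F 0.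
Proof.
move=> /integrableP[mF Foo].
have mF1 : measurable_fun setT (abse \o F : X -> \bar R) by exact: measurableT_comp.
rewrite giintB//; last first.
  by rewrite -(ge0_integral_gmeas mD mF1)// => y; exact: abse_ge0.
rewrite integralE !ge0_integral_gmeas//; first exact: measurable_funeneg.
exact: measurable_funepos.
Qed.

Lemma gmeas_probability : (forall k, leb (D k) = 1) -> gmeas mD (@setT X) = 1.
Proof.
move=> D1; rewrite /gmeas.
have H k x : giint D k (fun y : 'rV[R]_d => (\1_(@setT X) y)%:E) x = 1.
  elim: k x => [x|k IH x] /=; first by rewrite indicT.
  under eq_integral do rewrite IH.
  transitivity (1 * leb (D k)); last by rewrite D1 mule1.
  exact: (integral_cst leb (mD k)).
exact: H.
Qed.

Definition box (k : nat) : set X :=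
  [set y : 'rV[R]_d | forall j : 'I_d, (j < k)%N -> D j (y ord0 j)].

Lemma measurable_box k : measurable (box k).
Proof.
rewrite (_ : box k = \bigcap_(j in [set j : 'I_d | (j < k)%N])
  ((fun y : X => (y : 'rV[R]_d) ord0 j) @^-1` D j)).
  apply: fin_bigcap_measurable => // j _; rewrite -[X in measurable X]setTI.
  exact: (measurable_coord j).
by apply/seteqP; split=> y Dy j; exact: Dy.
Qed.

Lemma giint_box k F x : (k <= d)%N ->
  giint D k F x = giint (fun=> setT) k (F \_ (box k)) x.
Proof.
elim: k x => [x _|k IH x kd] /=; first by rewrite patchT// inE => j.
rewrite integral_mkcond; apply: eq_integral => t _; rewrite patchE.
case: ifPn => [|]; rewrite ?notin_setE ?inE => Dt.
  rewrite IH ?(ltnW kd)//; apply: giint_ext => y yx _; rewrite !patchE.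
  congr (if _ then _ else _); apply/idP/idP; rewrite !inE => By j; last first.
    by move=> jk; apply: By; rewrite ltnS ltnW.
  rewrite ltnS leq_eqVlt => /orP[/eqP jk|]; last exact: By.
  by rewrite yx ?jk// mxE jk eqxx.
apply: (etrans (esym (giint0_setT k (setc x k t)))); apply: giint_ext => y yx _.
rewrite /= patchN// notin_setE => By; apply: Dt.
have := By (Ordinal kd) (leqnn _); rewrite yx//=.
by rewrite mxE eqxx.
Qed.

Lemma gmeas_restr (A : set X) : gmeas mD A = gmeas (fun=> measurableT) (A `&` box d).
Proof.
rewrite /gmeas giint_box//; apply: eq_giint => y.
rewrite patchE !indicE in_setI.
by case: (y \in box d); rewrite ?andbT ?andbF.
Qed.

Lemma ge0_integral_gmeas_restr F : measurable_fun setT (F : X -> \bar R) ->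
  (forall y, 0 <= F y) ->
  \int[gmeas mD]_y F y = \int[gmeas (fun=> measurableT)]_(y in box d) F y.
Proof.
move=> mF F0; rewrite ge0_integral_gmeas// giint_box// integral_mkcond.
rewrite ge0_integral_gmeas//.
  apply/(measurable_restrictT _ (measurable_box d)); exact: measurable_funTS.
by move=> y; rewrite patchE; case: ifP.
Qed.

Lemma integral_gmeas_restr F : measurable_fun setT (F : X -> \bar R) ->
  \int[gmeas mD]_y F y = \int[gmeas (fun=> measurableT)]_(y in box d) F y.
Proof.
move=> mF; rewrite integralE [RHS]integralE !ge0_integral_gmeas_restr//.
  exact: measurable_funeneg.
exact: measurable_funepos.
Qed.

End IteratedFubini.

(** * Measure-preserving maps acting coordinate by coordinate *)

Section CoordinatewiseMap.
Context {R : realType} {d : nat} (D D' : nat -> set R).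
Hypotheses (mD : forall k, measurable (D k)) (mD' : forall k, measurable (D' k)).
Variable T : nat -> R -> R.
Hypothesis mT : forall k, measurable_fun setT (T k).
Local Notation X := (rVb R d).
Local Notation leb := (@lebesgue_measure R).
Local Open Scope ereal_scope.
Hypothesis pushT : forall k (h : R -> \bar R), measurable_fun setT h ->
  (forall t, 0 <= h t) -> \int[leb]_(t in D k) h (T k t) = \int[leb]_(t in D' k) h t.

Definition mapc (y : 'rV[R]_d) : 'rV[R]_d := \row_j T j (y ord0 j).

Lemma measurable_mapc : measurable_fun setT (mapc : X -> X).
Proof.
apply: measurable_fun_rV => i.
rewrite (_ : (fun _ => _) = fun y : X => T i ((y : 'rV[R]_d) ord0 i)).
  exact: (measurableT_comp (mT i) (measurable_coord i)).
by apply/funext => y; rewrite mxE.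
Qed.

(** Each induction step substitutes in the outermost variable only, by [pushT]; the base point moves
    along with the map. *)
Lemma ge0_giint_mapc k (F : 'rV[R]_d -> \bar R) x :
  measurable_fun setT (F : X -> \bar R) -> (forall y, 0 <= F y) ->
  giint D k (F \o mapc) x = giint D' k F (mapc x).
Proof.
move=> mF F0; elim: k x => //= k IH x.
rewrite -(pushT k (measurable_giint_setc mD' k (mapc x) mF)).
  apply: eq_integral => t _; rewrite IH; congr giint; apply/rowP => j; rewrite !mxE.
  by case: eqP => [->|].
by move=> t; exact: giint_ge0.
Qed.

Lemma ge0_integral_mapc (F : 'rV[R]_d -> \bar R) :
  measurable_fun setT (F : X -> \bar R) -> (forall y, 0 <= F y) ->
  \int[gmeas mD]_y F (mapc y) = \int[gmeas mD']_y F y.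
Proof.
move=> mF F0; rewrite !ge0_integral_gmeas//.
  have -> := ge0_giint_mapc d 0 mF F0.
  (* All [d] coordinates are integrated, so the base point [mapc 0] may be replaced by [0]. *)
  by apply: giint_base => j; rewrite leqNgt ltn_ord.
exact: (measurableT_comp mF measurable_mapc).
Qed.

Lemma integral_mapc (F : 'rV[R]_d -> \bar R) : measurable_fun setT (F : X -> \bar R) ->
  \int[gmeas mD]_y F (mapc y) = \int[gmeas mD']_y F y.
Proof.
move=> mF; rewrite integralE [RHS]integralE.
congr (_ - _).
  have <- := ge0_integral_mapc (measurable_funepos mF) (funepos_ge0 F).
  by apply: eq_integral => y _; rewrite !funeposE.
have <- := ge0_integral_mapc (measurable_funeneg mF) (funeneg_ge0 F).
by apply: eq_integral => y _; rewrite !funenegE.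
Qed.

End CoordinatewiseMap.

(** * Affine changes of variable on the line *)

Section AffineChange.
Context {R : realType}.
Local Notation leb := (@lebesgue_measure R).
Local Open Scope ereal_scope.

Lemma measurable_affine (a b : R) : measurable_fun setT (fun t : R => a * t + b)%R.
Proof. by apply: measurable_funD => //; apply: measurable_funM. Qed.

Lemma lebesgue_affine_ocitv (a b x y : R) : a != 0%R ->
  leb ((fun t => a * t + b)%R @^-1` `]x, y]%classic) = (`|a|^-1)%:E * leb `]x, y]%classic.
Proof.
move=> a0; have [apos|aneg|] := ltgtP 0%R a; last by move=> a0'; rewrite -a0' eqxx in a0.
- rewrite (_ : _ @^-1` _ = `]((x - b) / a)%R, ((y - b) / a)%R]%classic); last first.
    apply/seteqP; split=> t /=; rewrite !in_itv/= ltr_pdivrMr// ler_pdivlMr//;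
    by rewrite mulrC => /andP[? ?]; apply/andP; split; lra.
  rewrite !lebesgue_measure_itv/= !lte_fin ltr_pM2r ?invr_gt0// ltrD2r gtr0_norm//.
  case: ifP => _; last by rewrite mule0.
  by rewrite -!EFinB -EFinM; congr EFin; field.
- rewrite (_ : _ @^-1` _ = `[((y - b) / a)%R, ((x - b) / a)%R[%classic); last first.
    apply/seteqP; split=> t /=; rewrite !in_itv/= ltr_ndivlMr// ler_ndivrMr//;
    by rewrite mulrC => /andP[? ?]; apply/andP; split; lra.
  rewrite !lebesgue_measure_itv/= !lte_fin ltr_nM2r ?invr_lt0// ltrD2r ltr0_norm//.
  case: ifP => _; last by rewrite mule0.
  by rewrite -!EFinB -EFinM; congr EFin; field.
Qed.

(** The push-forward rescaled by [|a|] agrees with Lebesgue measure on half-open intervals, and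
    these determine it. *)
Lemma lebesgue_affine (a b : R) (A : set R) : a != 0%R -> measurable A ->
  leb ((fun t => a * t + b)%R @^-1` A) = (`|a|^-1)%:E * leb A.
Proof.
move=> a0 mA.
have an0 : (`|a| != 0)%R by rewrite normr_eq0.
pose T : measurableTypeR R -> measurableTypeR R := fun t => (a * t + b)%R.
have mT : measurable_fun setT T by exact: measurable_affine.
pose nu0 := @measure_function_pushforward__canonical__measure_function_Measure _ _
  (measurableTypeR R) (measurableTypeR R) R leb T mT.
pose nu := mscale (NngNum (normr_ge0 a)) nu0.
have nuE (B : set R) : nu B = `|a|%:E * leb ((fun t => a * t + b)%R @^-1` B) by [].
have H : leb A = `|a|%:E * leb ((fun t => a * t + b)%R @^-1` A).
  apply: (etrans (@lebesgue_measure_unique _ nu _ A mA)); last exact: nuE.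
  move=> _ [[x y] _ <-] /=; apply: (etrans _ (esym (nuE _))).
  by rewrite lebesgue_affine_ocitv// muleA -EFinM divff// mul1e.
by rewrite H muleA -EFinM mulVf// mul1e.
Qed.

Lemma ge0_integral_affine (a b : R) (h : R -> \bar R) : a != 0%R ->
  measurable_fun setT h -> (forall t, 0 <= h t) ->
  \int[leb]_t h (a * t + b)%R = (`|a|^-1)%:E * \int[leb]_t h t.
Proof.
move=> a0 mh h0.
have ia0 : (0 <= `|a|^-1)%R by rewrite invr_ge0.
pose T : measurableTypeR R -> measurableTypeR R := fun t => (a * t + b)%R.
have := @ge0_integral_pushforward _ _ (measurableTypeR R) (measurableTypeR R) R T
   (measurable_affine a b) leb setT h measurableT mh (fun t _ => h0 t).
rewrite preimage_setT => <-.
transitivity (\int[mscale (NngNum ia0) leb]_t h t); last by rewrite ge0_integral_mscale.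
have mT : measurable_fun setT T by exact: measurable_affine.
apply: (@eq_measure_integral _ _ _ _ _
  (@measure_function_pushforward__canonical__measure_function_Measure _ _
    (measurableTypeR R) (measurableTypeR R) R leb T mT)) => A mA _.
exact: (@lebesgue_affine a b A a0 mA).
Qed.

Lemma ge0_integral_affine_set (a b : R) (A B : set R) (h : R -> \bar R) : a != 0%R ->
  measurable B -> (forall t, A t <-> B (a * t + b)%R) ->
  measurable_fun setT h -> (forall t, 0 <= h t) ->
  \int[leb]_(t in A) h (a * t + b)%R = (`|a|^-1)%:E * \int[leb]_(t in B) h t.
Proof.
move=> a0 mB AB mh h0; rewrite integral_mkcond [in RHS]integral_mkcond.
rewrite -(@ge0_integral_affine a b)//.
- apply: eq_integral => t _; rewrite !patchE; congr (if _ then _ else _).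
  by apply/idP/idP; rewrite !inE => /AB.
- by apply/(measurable_restrictT _ mB); exact: measurable_funTS.
- by move=> t; rewrite patchE; case: ifP.
Qed.

Lemma ge0_integral_reflect (h : R -> \bar R) : measurable_fun setT h ->
  (forall t, 0 <= h t) ->
  \int[leb]_(t in `[0%R, 1%R]) h (1 - t)%R = \int[leb]_(t in `[0%R, 1%R]) h t.
Proof.
move=> mh h0; transitivity (\int[leb]_(t in `[0%R, 1%R]) h (-1 * t + 1)%R).
  by apply: eq_integral => t _; rewrite mulN1r addrC.
rewrite (@ge0_integral_affine_set _ _ _ `[0%R, 1%R]%classic)//.
- by rewrite normrN1 invr1 mul1e.
- by move=> t /=; rewrite !in_itv/=; split=> /andP[? ?]; apply/andP; split; lra.
Qed.

(** Two affine branches, of slopes [-2] and [2], each cover the unit interval once and contribute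
    one half. Their images differ from the open interval only by end points; the open one is taken
    so that the cubes become disjoint. *)
Lemma ge0_integral_tent (m : R) (h : R -> \bar R) : measurable_fun setT h ->
  (forall t, 0 <= h t) ->
  \int[leb]_(t in `[0%R, 1%R]) h (`|2 * t - 1| - m)%R =
  \int[leb]_(t in `](- m)%R, (1 - m)%R[) h t.
Proof.
move=> mh h0.
have mh' : measurable_fun setT (fun t : R => h (`|2 * t - 1| - m)%R).
  apply: (measurableT_comp mh); apply: measurable_funB => //.
  by apply: measurableT_comp => //; exact: (measurable_affine 2 (-1)).
have half : (0 <= 2^-1 :> R)%R by rewrite invr_ge0.
have half1 : (2^-1 <= 1 :> R)%R by rewrite invf_le1// ler1n.
have ti : (2%R != 0%R :> R) by rewrite pnatr_eq0.
rewrite (@itv_bndbnd_setU _ _ _ (BLeft 2^-1%R)) ?bnd_simp//.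
rewrite ge0_integral_setU//=; last 2 first.
- exact: measurable_funTS.
- apply/disj_setPS => t [] /=; rewrite !in_itv/= => /andP[_ t1] /andP[t2 _].
  by move: (le_lt_trans t2 t1); rewrite ltxx.
have -> : \int[leb]_(t in `[0%R, 2^-1%R[) h (`|2 * t - 1| - m)%R =
    \int[leb]_(t in `[0%R, 2^-1%R[) h (-2 * t + (1 - m))%R.
  apply: eq_integral => t; rewrite inE/= in_itv/= => /andP[_ t1]; congr h.
  rewrite ltr0_norm; last by rewrite subr_lt0 -ltr_pdivlMl// mulr1.
  by rewrite opprB mulNr [RHS]addrC addrAC.
have -> : \int[leb]_(t in `[2^-1%R, 1%R]) h (`|2 * t - 1| - m)%R =
    \int[leb]_(t in `[2^-1%R, 1%R]) h (2 * t + (- 1 - m))%R.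
  apply: eq_integral => t; rewrite inE/= in_itv/= => /andP[t1 _]; congr h.
  by rewrite ger0_norm ?addrA// subr_ge0 -ler_pdivrMl// mulr1.
rewrite (@ge0_integral_affine_set (-2)%R (1 - m)%R _ `](- m)%R, (1 - m)%R]%classic)//; last first.
  move=> t /=; rewrite !in_itv/=; split=> /andP[? ?]; apply/andP; split; lra.
rewrite (@ge0_integral_affine_set 2%R (- 1 - m)%R _ `[(- m)%R, (1 - m)%R]%classic)//; last first.
  move=> t /=; rewrite !in_itv/=; split=> /andP[? ?]; apply/andP; split; lra.
have mh2 (B : set R) : measurable_fun B h by exact: measurable_funTS.
rewrite (@integral_itv_bndoo _ _ _ _ false false)// (@integral_itv_bndoo _ _ _ _ true false)//.
rewrite normrN gtr0_norm//.
rewrite -ge0_muleDl ?lee_fin// -EFinD.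
by rewrite (_ : 2^-1 + 2^-1 = 1)%R ?mul1e//; field.
Qed.

End AffineChange.

(** * Smooth cut-off functions on the line *)

Section SmoothLine.
Context {R : realType}.
Implicit Types (f g : R -> R) (P : {poly R}).

Lemma is_derive_add f g (x a b : R) : is_derive x 1 f a -> is_derive x 1 g b ->
  is_derive x 1 (fun u => f u + g u) (a + b).
Proof. by move=> fa gb; exact: is_deriveD. Qed.

Lemma is_derive_mul f g (x a b : R) : is_derive x 1 f a -> is_derive x 1 g b ->
  is_derive x 1 (fun u => f u * g u) (a * g x + f x * b).
Proof.
move=> fa gb; apply: (is_derive_eq (is_deriveM fa gb)).
by rewrite /GRing.scale/= addrC mulrC.
Qed.

Lemma is_derive_affine (a b x l : R) f : is_derive (a * x + b) 1 f l ->
  is_derive x 1 (fun u => f (a * u + b)) (a * l).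
Proof.
move=> fl; rewrite mulrC; apply: (@is_derive1_comp _ f (fun u => a * u + b)) => //.
have := is_derive_add (is_derive_mul (is_derive_cst a x 1) (is_derive_id x 1))
  (is_derive_cst b x 1).
by move=> H; apply: (is_derive_eq H); rewrite mul0r add0r addr0 mulr1.
Qed.

(** Contains exp(-1/u) as [flat 1] and is stable under differentiation, which only changes the
    polynomial in 1/u. *)
Definition flat P (u : R) : R := if 0 < u then P.[u^-1] * expR (- u^-1) else 0.

Lemma exp_pow_le_fact (y : R) n : 0 <= y -> y ^+ n * expR (- y) <= n`!%:R.
Proof.
move=> y0; rewrite expRN ler_pdivrMr ?expR_gt0//.
case: n => [|n]; first by rewrite expr0 fact0 mul1r -expR0 ler_expR.
rewrite mulrC -ler_pdivrMr ?ltr0n ?fact_gt0//.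
by apply: le_trans (expR_ge1Dxn n y0); rewrite lerDr.
Qed.

(** With [y] for 1/u, each monomial is controlled by the inequality of [exp_pow_le_fact]. *)
Lemma flat_bounded P : exists C : R, 0 <= C /\ forall u, `|flat P u| <= C.
Proof.
exists (\sum_(i < size P) `|P`_i| * i`!%:R); split.
  by apply: sumr_ge0 => i _; rewrite mulr_ge0.
move=> u; rewrite /flat; case: ifPn => [u0|_]; last first.
  by rewrite normr0; apply: sumr_ge0 => i _; rewrite mulr_ge0.
rewrite normrM (ger0_norm (expR_ge0 _)) horner_coef.
apply: (@le_trans _ _ ((\sum_(i < size P) `|P`_i * u^-1 ^+ i|) * expR (- u^-1))).
  by rewrite ler_wpM2r ?expR_ge0// ler_norm_sum.
rewrite mulr_suml; apply: ler_sum => i _.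
rewrite normrM -mulrA ler_wpM2l// normrX ger0_norm ?invr_ge0 ?(ltW u0)//.
by apply: exp_pow_le_fact; rewrite invr_ge0 ltW.
Qed.

(** A factor ['X] in the polynomial is worth a factor 1/u. This identity yields continuity and
    differentiability at [0], decay at infinity, and later the exchange of powers of the scale for
    powers of the distance to an end point. *)
Lemma flatXM P u : flat P u = u * flat ('X * P) u.
Proof.
rewrite /flat; case: ifPn => [u0|_]; last by rewrite mulr0.
by rewrite hornerM hornerX !mulrA divff ?mul1r// gt_eqF.
Qed.

Lemma flat0 P u : u <= 0 -> flat P u = 0.
Proof. by rewrite /flat ltNge => ->. Qed.

Lemma flat_cvg0 P : flat P u @[u --> (0 : R)] --> (0 : R).
Proof.
have [C [C0 PC]] := flat_bounded ('X * P).
apply: norm_cvg0; apply: (@squeeze_cvgr _ _ _ _ (fun=> 0) (fun u => C * `|u|)).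
- apply: nearW => u; rewrite normr_ge0/= flatXM normrM mulrC.
  by rewrite ler_wpM2r.
- exact: cvg_cst.
- have : C * `|u| @[u --> (0 : R)] --> C * `|0 : R|.
    by apply: cvgMr; apply: cvg_norm; exact: cvg_id.
  by rewrite [X in _ --> X -> _](_ : _ = 0)// normr0 mulr0.
Qed.

Lemma is_derive_flat P (u : R) : is_derive u 1 (flat P) (flat ('X^2 * (P - P^`())) u).
Proof.
have [u0|u0|->] := ltgtP u 0.
- rewrite [X in is_derive _ _ _ X]flat0 ?ltW//.
  apply: (@near_eq_is_derive _ _ _ (cst 0)); last first.
  near=> t; rewrite flat0//=; apply: ltW; near: t.
  exact: lt_nbhsl.
- have un0 : u != 0 by rewrite gt_eqF.
  have dV : is_derive u 1 (fun t : R => t^-1) (- u ^- 2).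
    by apply: (is_derive_eq (is_deriveV un0 (is_derive_id u 1))); rewrite scaler1.
  have dNV : is_derive u 1 (fun t : R => - t^-1) (u ^- 2).
    by apply: (is_derive_eq (is_deriveN dV)); rewrite opprK.
  have dP := @is_derive1_comp _ (horner P) _ u _ _ (is_derive_poly P u^-1) dV.
  have dE := @is_derive1_comp _ expR _ u _ _ (is_derive_expR (- u^-1)) dNV.
  have dPE := is_derive_mul dP dE.
  rewrite [X in is_derive _ _ _ X](_ : _ = P^`().[u^-1] * - u ^- 2 * expR (- u^-1) +
    P.[u^-1] * (expR (- u^-1) * u ^- 2)); last first.
    by rewrite /flat u0 !hornerE/= exprVn; ring.
  apply: (near_eq_is_derive _ dPE).
  near=> t; rewrite /flat ifT//; near: t.
  exact: lt_nbhsr.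
- rewrite [X in is_derive _ _ _ X]flat0//; apply/is_derive1_caratheodory.
  (* By [flatXM] the difference quotient at [0] is [flat ('X * P)], which tends to [0]. *)
  exists (flat ('X * P)); split; last by rewrite flat0.
  + by move=> z; rewrite [in flat P 0]flat0// !subr0 mulrC -flatXM.
  + by rewrite /prop_for /continuous_at flat0//; exact: flat_cvg0.
Unshelve. all: by end_near. Qed.

(** A syntactic class closed under differentiation: smoothness of every order follows from one
    derivative per constructor. The phase [b] of the cosine makes the sine available as a shifted
    cosine. *)
Inductive smc : (R -> R) -> Prop :=
| smc_cst c : smc (fun=> c)
| smc_cos a b : smc (fun u => cos (a * u + b))
| smc_flat P a b : smc (fun u => flat P (a * u + b))
| smc_add f g : smc f -> smc g -> smc (fun u => f u + g u)
| smc_mul f g : smc f -> smc g -> smc (fun u => f u * g u).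

Lemma smc_is_derive f : smc f ->
  exists2 g, smc g & forall x : R, is_derive x 1 f (g x).
Proof.
elim=> [c|a b|P a b|f1 f2 _ [g1 s1 d1] _ [g2 s2 d2]|f1 f2 S1 [g1 s1 d1] S2 [g2 s2 d2]].
- exists (fun=> 0); first exact: smc_cst.
  by move=> x; exact: is_derive_cst.
- exists (fun u => a * cos (a * u + (b + pi / 2))).
    by apply: smc_mul; [exact: smc_cst|exact: smc_cos].
  move=> x; rewrite addrA cosDpihalf; apply: is_derive_affine; exact: is_derive_cos.
- exists (fun u => a * flat ('X^2 * (P - P^`())) (a * u + b)).
    by apply: smc_mul; [exact: smc_cst|exact: smc_flat].
  by move=> x; apply: is_derive_affine; exact: is_derive_flat.
- exists (fun u => g1 u + g2 u); first exact: smc_add.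
  by move=> x; exact: is_derive_add.
- exists (fun u => g1 u * f2 u + f1 u * g2 u).
    by apply: smc_add; exact: smc_mul.
  by move=> x; exact: is_derive_mul.
Qed.

Lemma derive1_eq f g : (forall x : R, is_derive x 1 f (g x)) -> f^`()%classic = g.
Proof. by move=> fg; apply/funext => x; rewrite derive1E; exact: derive_val. Qed.

Lemma smc_derivable f x : smc f -> derivable f x 1.
Proof. by move=> /smc_is_derive[g _ /(_ x)[]]. Qed.

Lemma smc_derive1 f : smc f -> smc f^`()%classic.
Proof. by move=> /smc_is_derive[g sg /derive1_eq ->]. Qed.

Lemma smc_continuous f : smc f -> continuous f.
Proof.
by move=> sf x; apply: differentiable_continuous; apply/derivable1_diffP; exact: smc_derivable.
Qed.

Lemma cvg_scaled g (l C v : R) : (forall y, 0 < y -> `|g y - l| <= C / y) -> 0 < v ->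
  g (n.+1%:R * v) @[n --> \oo] --> l.
Proof.
move=> gl v0; apply/subr_cvg0.
apply/norm_cvg0P; apply: (@squeeze_cvgr _ _ _ _ (fun=> 0) (fun n => (C / v) * n.+1%:R^-1)).
- near=> n; rewrite normr_ge0/= (le_trans (gl _ _)) ?mulr_gt0//.
  by rewrite invfM mulrA mulrAC.
- exact: cvg_cst.
- rewrite -[X in _ --> X](mulr0 (C / v)); apply: cvgMr.
  exact: (@cvg_harmonic R).
Unshelve. all: by end_near. Qed.

Lemma flat1_cvg (v : R) : 0 < v -> flat 1 (n.+1%:R * v) @[n --> \oo] --> (1 : R).
Proof.
apply: (@cvg_scaled _ _ 1) => y y0; rewrite /flat y0 hornerC !mul1r.
rewrite ler0_norm; last by rewrite subr_le0 -expR0 ler_expR oppr_le0 invr_ge0 ltW.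
rewrite opprB lerBlDr -lerBlDl.
by have := expR_ge1Dx (- y^-1); lra.
Qed.

(** By [flatXM] this is a bounded function divided by its argument. *)
Lemma flatXM_cvg P (v : R) : 0 < v -> flat ('X * P) (n.+1%:R * v) @[n --> \oo] --> (0 : R).
Proof.
have [C [C0 PC]] := flat_bounded P.
apply: (@cvg_scaled _ _ C) => y y0; rewrite subr0 ler_pdivlMr//.
by rewrite -[X in _ * X](ger0_norm (ltW y0)) -normrM mulrC -flatXM.
Qed.

Lemma flat1_nd (u v : R) : u <= v -> flat 1 u <= flat 1 v.
Proof.
rewrite /flat => uv; case: ifPn => [u0|_]; last first.
  by case: ifPn => // _; rewrite hornerC mul1r expR_ge0.
rewrite (lt_le_trans u0 uv) !hornerC !mul1r ler_expR lerN2 lef_pV2 ?posrE//.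
exact: lt_le_trans uv.
Qed.

Lemma flat1_ge0 (u : R) : 0 <= flat 1 u.
Proof. by rewrite /flat; case: ifP => // _; rewrite hornerC mul1r expR_ge0. Qed.

Lemma flat1_le1 (u : R) : flat 1 u <= 1.
Proof.
rewrite /flat; case: ifP => // u0; rewrite hornerC mul1r -expR0 ler_expR.
by rewrite oppr_le0 invr_ge0 ltW.
Qed.

Definition cutoff (a b s u : R) : R := flat 1 (s * (u - a)) * flat 1 (s * (b - u)).

Lemma smc_cutoff a b s : smc (cutoff a b s).
Proof.
rewrite (_ : cutoff a b s = fun u => flat 1 (s * u + (- s * a)) * flat 1 (- s * u + s * b)).
  by apply: smc_mul; exact: smc_flat.
by apply/funext => u; rewrite /cutoff; congr (flat _ _ * flat _ _); ring.
Qed.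

Lemma cutoff_ge0 a b s u : 0 <= cutoff a b s u.
Proof. by rewrite mulr_ge0// flat1_ge0. Qed.

Lemma cutoff_le1 a b s u : cutoff a b s u <= 1.
Proof. by rewrite mulr_ile1// ?flat1_ge0// flat1_le1. Qed.

Lemma cutoff_eq0 a b s u : 0 <= s -> ~ (a < u < b) -> cutoff a b s u = 0.
Proof.
move=> s0 /negP; rewrite negb_and -!leNgt => /orP[ua|bu]; rewrite /cutoff.
  by rewrite flat0 ?mul0r// mulr_ge0_le0// subr_le0.
by rewrite [X in _ * X]flat0 ?mulr0// mulr_ge0_le0// subr_le0.
Qed.

End SmoothLine.

(** * Tensor products of smooth functions are test functions *)

Section Tensor.
Context {R : realType} {d : nat}.
Implicit Types (th : 'I_d -> R -> R) (x : 'rV[R]_d).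

Definition tensor th x : R := \prod_i th i (x ord0 i).

Lemma tensor_setc th x (i : 'I_d) (t : R) :
  tensor th (setc x i t) = th i t * \prod_(j | j != i) th j (x ord0 j).
Proof.
rewrite /tensor (bigD1 i)//= setc_eq; congr (_ * _).
by apply: eq_bigr => j ji; rewrite setc_neq.
Qed.

Lemma tensor_continuous th : (forall i, continuous (th i)) -> continuous (tensor th).
Proof.
move=> cth x; rewrite /tensor; elim: (index_enum _) => [|i r IH].
  rewrite (_ : (fun _ => _) = cst 1); first exact: cst_continuous.
  by apply/funext => y; rewrite big_nil.
rewrite (_ : (fun _ => _) = (fun y : 'rV[R]_d =>
    th i (y ord0 i) * \prod_(j <- r) th j (y ord0 j))); last first.
  by apply/funext => y; rewrite big_cons.
apply: (@continuousM _ _ (fun y : 'rV[R]_d => th i (y ord0 i))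
  (fun y : 'rV[R]_d => \prod_(j <- r) th j (y ord0 j))) => //.
apply: (@continuous_comp _ _ _ (fun y : 'rV[R]_d => y ord0 i) (th i)).
  exact: coord_continuous.
exact: cth.
Qed.

Definition updD th (i : 'I_d) : 'I_d -> R -> R :=
  fun j => if j == i then (th j)^`()%classic else th j.

Lemma is_derive_tensor th x (i : 'I_d) : (forall j, smc (th j)) ->
  is_derive (x ord0 i) 1 (fun t => tensor th (setc x i t)) (tensor (updD th i) x).
Proof.
move=> sth; set c := \prod_(j | j != i) th j (x ord0 j).
rewrite (_ : (fun _ => _) = (fun t => th i t * c)); last first.
  by apply/funext => t; rewrite tensor_setc.
have [g sg dg] := smc_is_derive (sth i).
have -> : tensor (updD th i) x = g (x ord0 i) * c.
  rewrite /tensor (bigD1 i)//= /updD eqxx (derive1_eq dg); congr (_ * _).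
  by apply: eq_bigr => j /negPf ->.
apply: (is_derive_eq (is_derive_mul (dg _) (is_derive_cst c (x ord0 i) 1))).
by rewrite mulr0 addr0.
Qed.

Lemma smc_updD th i : (forall j, smc (th j)) -> forall j, smc (updD th i j).
Proof. by move=> sth j; rewrite /updD; case: eqP => // _; exact: smc_derive1. Qed.

Lemma smc_updDs th s : (forall j, smc (th j)) ->
  forall j, smc (foldr (fun i th' => updD th' i) th s j).
Proof. by move=> sth; elim: s => //= i s IH; exact: smc_updD. Qed.

Lemma pD_tensor th s : (forall j, smc (th j)) ->
  pD s (tensor th) = tensor (foldr (fun i th' => updD th' i) th s).
Proof.
move=> sth; elim: s => //= i s ->; apply/funext => x; rewrite /pderiv derive1E.
have := is_derive_tensor x i (smc_updDs s sth).
by case.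
Qed.

Lemma tensor_smooth th : (forall j, smc (th j)) -> smooth (tensor th).
Proof.
move=> sth s; rewrite pD_tensor//; split.
  by apply: tensor_continuous => i; apply: smc_continuous; exact: smc_updDs.
by move=> i x; have [] := is_derive_tensor x i (smc_updDs s sth).
Qed.

Lemma tensor_test_fun th (a b : 'I_d -> R) : (forall j, smc (th j)) ->
  (forall j u, ~ (a j <= u <= b j) -> th j u = 0) -> test_fun (tensor th).
Proof.
move=> sth th0; split; first exact: tensor_smooth.
pose B := [set v : 'rV[R]_d | forall i, `[a i, b i]%classic (v ord0 i)].
have cB : compact B.
  apply: (@rV_compact R d (fun i => `[a i, b i]%classic)) => i; exact: segment_compact.
apply: (subclosed_compact _ cB); first exact: closed_closure.
have clB : closed B.
  apply: compact_closed => //; exact: norm_hausdorff.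
rewrite [X in _ `<=` X](closure_id B).1//; apply: closure_subset => x /= /eqP xn0 i.
rewrite /= in_itv/=; apply: contrapT => /th0 thx; apply: xn0.
by rewrite /tensor (bigD1 i)//= thx mul0r.
Qed.

(** On a product of functions of one variable the order of the partial derivatives is immaterial;
    only their number in each direction counts. *)
Lemma foldr_updD th s j :
  foldr (fun i th' => updD th' i) th s j = derive1n (count_mem j s) (th j).
Proof.
elim: s => //= i s IH; rewrite /updD eq_sym; by case: (i == j); rewrite IH.
Qed.

Lemma count_mixseq (e : {set 'I_d}) j : count_mem j (mixseq e) = (j \in e).*2.
Proof.
rewrite -mem_enum /mixseq -count_uniq_mem ?enum_uniq//.
elim: (enum _) => //= i s IH; rewrite IH doubleD; case: (i == j) => //=.
Qed.

Lemma pD_mixseq th (e : {set 'I_d}) : (forall j, smc (th j)) ->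
  pD (mixseq e) (tensor th) =
  tensor (fun j => if j \in e then (th j)^`()^`()%classic else th j).
Proof.
move=> sth; rewrite pD_tensor//; congr tensor; apply/funext => j.
by rewrite foldr_updD count_mixseq; case: (j \in e).
Qed.

Lemma measurable_tensor th : (forall i, continuous (th i)) ->
  measurable_fun setT (tensor th : rVb R d -> R).
Proof. by move=> cth; apply: continuous_measurable_rV; exact: tensor_continuous. Qed.

End Tensor.

(** * Almost everywhere equality from integrals against cutoffs *)

Section Fundamental.
Context {R : realType}.
Local Notation leb := (@lebesgue_measure R).
Local Notation RR := (measurableTypeR R).
Implicit Types (I J : R -> \bar R) (D : R -> R).
Local Open Scope ereal_scope.

(** Rational parameters make the family countable, so that the exceptional null sets of the single
    cut-offs can be united into one. *)
Definition rcutoff (c : rat * rat * nat) : R -> R :=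
  cutoff (ratr c.1.1) (ratr c.1.2) c.2.+1%:R.

Lemma smc_rcutoff c : smc (rcutoff c). Proof. exact: smc_cutoff. Qed.

Lemma measurable_rcutoff c : measurable_fun setT (rcutoff c).
Proof. by apply: continuous_measurable_fun; exact/smc_continuous/smc_rcutoff. Qed.

Lemma rcutoff_ge0 c t : (0 <= rcutoff c t)%R. Proof. exact: cutoff_ge0. Qed.

Lemma rcutoff_le1 c t : (rcutoff c t <= 1)%R. Proof. exact: cutoff_le1. Qed.

Lemma fin_numB_ltDy (a b : \bar R) : 0 <= a -> 0 <= b -> a - b \is a fin_num -> a + b < +oo.
Proof. by case: a b => [r| |] [s| |]//= _ _ _; exact: ltry. Qed.

Lemma ae_conj (P Q : R -> Prop) : {ae leb, forall t, P t} -> {ae leb, forall t, Q t} ->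
  {ae leb, forall t, P t /\ Q t}.
Proof.
move=> p q; have := negligibleU p q; apply: negligibleS => t /= PQ.
by have [Pt|] := pselect (P t); [right=> Qt; apply: PQ|left].
Qed.

(** The integral is a difference of two non-negative ones, and with [oo - oo = -oo] a finite
    difference has finite terms. The slices of [f] owe their integrability to this. *)
Lemma fin_num_integral_integrable I : measurable_fun setT I ->
  \int[leb]_t I t \is a fin_num -> leb.-integrable setT I.
Proof.
move=> mI; rewrite integralE => fI; apply/integrableP; split => //.
have p0 : 0 <= \int[leb]_t I^\+ t by exact: integral_ge0.
have n0 : 0 <= \int[leb]_t I^\- t by exact: integral_ge0.
rewrite (_ : \int[leb]_t `|I t| = \int[leb]_t I^\+ t + \int[leb]_t I^\- t).
  exact: fin_numB_ltDy.
rewrite -ge0_integralD//; [|exact: measurable_funepos|exact: measurable_funeneg].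
by apply: eq_integral => t _; exact: (congr1 (fun h => h t) (fune_abse I)).
Qed.

(* [e^-2] is the minimum over [-n, n] of the cutoff of scale 1 on [-n-1, n+1]. *)
Lemma rcutoff_lower (n : nat) t : (- n%:R <= t <= n%:R)%R ->
  (expR (- 2) <= rcutoff (- n.+1%:R, n.+1%:R, 0) t)%R.
Proof.
move=> /andP[t1 t2]; rewrite /rcutoff/= /cutoff rmorphN/= ratr_nat !mul1r opprK.
have t1' : (1 <= t + n.+1%:R)%R by rewrite -natr1; lra.
have t2' : (1 <= n.+1%:R - t)%R by rewrite -natr1; lra.
have H u : (1 <= u)%R -> (expR (-1) <= flat 1 u)%R.
  move=> u1; rewrite /flat ifT ?(lt_le_trans _ u1)// hornerC mul1r ler_expR lerN2.
  by rewrite invf_le1// (lt_le_trans _ u1).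
rewrite (_ : -2 = -1 + -1)%R ?expRD; last by rewrite -opprD.
by apply: ler_pM; rewrite ?expR_ge0// H.
Qed.

(** On the interval the cut-off is at least [expR (- 2)], so dividing by it costs a factor
    [expR 2]. *)
Lemma integrable_itv_of_rcutoff I (n : nat) : measurable_fun setT I ->
  (forall c, leb.-integrable setT (fun t => (rcutoff c t)%:E * I t)) ->
  leb.-integrable `[(- n%:R)%R, n%:R%R] I.
Proof.
move=> mI iI; set c := ((- n.+1%:R)%R : rat, n.+1%:R%R : rat, 0%N).
have i1 : leb.-integrable `[(- n%:R)%R, n%:R%R] (fun t => (rcutoff c t)%:E * I t).
  exact: (@integrableS _ RR R leb setT).
have iZ := @integrableZl _ RR R leb _ (measurable_itv _) (expR 2) _ i1.
apply: (@le_integrable _ RR R leb _ _ _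
   (fun t => (expR 2)%:E * ((rcutoff c t)%:E * I t))) => //.
- exact: measurable_funTS.
- move=> t /=; rewrite in_itv/= => tn; rewrite muleA abseM -[leLHS]mul1e lee_wpmul2r//.
  rewrite -EFinM abse_EFin lee_fin ger0_norm; last first.
    by apply: mulr_ge0; [exact: expR_ge0|exact: rcutoff_ge0].
  rewrite -ler_pdivrMl ?expR_gt0// mulr1 -expRN; exact: rcutoff_lower.
Qed.

Lemma ae_fin_of_rcutoff I : measurable_fun setT I ->
  (forall c, leb.-integrable setT (fun t => (rcutoff c t)%:E * I t)) ->
  {ae leb, forall t, I t \is a fin_num}.
Proof.
move=> mI iI.
have H (n : nat) : {ae leb, forall t, `[(- n%:R)%R, n%:R%R]%classic t -> I t \is a fin_num}.
  apply: (@integrable_ae _ RR R leb _ (measurable_itv _) I).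
  exact: integrable_itv_of_rcutoff.
have := ae_foralln H; apply: ae_imply => t Ht.
apply: (Ht (Num.trunc `|t|).+1); rewrite /= in_itv/= -ler_norml.
by rewrite ltW// truncnS_gt.
Qed.

(** The rational end points approach [p] and [q] from inside, so the cut-offs vanish off the
    interval, while the growing scale [n.+1] drives them to [1] inside. *)
Lemma rcutoff_cvg_seq (p q : R) : (p < q)%R -> exists c : nat -> rat * rat * nat,
  (forall n t, ~ (p < t < q)%R -> rcutoff (c n) t = 0%R) /\
  (forall t, (p < t < q)%R -> rcutoff (c n) t @[n --> \oo] --> (1 : R)%R).
Proof.
move=> pq.
have rat_ex (x : R) n : exists r : rat, (x < ratr r < x + n.+1%:R^-1)%R.
  have : (x < x + n.+1%:R^-1)%R by rewrite ltrDl invr_gt0.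
  by move=> /rat_in_itvoo[r]; rewrite in_itv/= => ?; exists r.
have [a aP] := boolp.choice (rat_ex p).
(* Rationals just above [- q]; their opposites approach [q] from below. *)
have [b bP] := boolp.choice (fun n => rat_ex (- q)%R n).
exists (fun n => (a n, - b n, n)%R); split=> [n t pqt|t /andP[pt tq]].
  apply: cutoff_eq0 => //=; apply: contra_not pqt => /andP[t1 t2].
  have /andP[a1 _] := aP n; have /andP[b1 _] := bP n.
  by move: t2; rewrite rmorphN/= => t2; apply/andP; split; lra.
rewrite -[X in _ --> X](mulr1 1%R); rewrite /rcutoff /cutoff.
(* The distance [y n] to a moving end point is eventually at least [v / 2], and [flat 1] is
   monotone. *)
have side (y : nat -> R) (v : R) : (0 < v)%R -> (forall n, v - n.+1%:R^-1 <= y n)%R ->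
    flat 1 (n.+1%:R * y n) @[n --> \oo] --> (1 : R)%R.
  move=> v0 vy; apply: (@squeeze_cvgr _ _ _ _ (fun n => flat 1 (n.+1%:R * (v / 2))%R) (fun=> 1%R)).
  - near=> n; rewrite flat1_le1 andbT; apply: flat1_nd; rewrite ler_pM2l//.
    apply: le_trans (vy n).
    suff : (n.+1%:R^-1 <= v / 2)%R by move: (n.+1%:R^-1)%R => e ev; lra.
    rewrite invf_ple ?posrE ?divr_gt0//.
    apply: (@le_trans _ _ n%:R); last by rewrite ler_nat.
    by near: n; exact: nbhs_infty_ger.
  - by apply: flat1_cvg; rewrite divr_gt0.
  - exact: cvg_cst.
apply: cvgM.
- apply: (side _ (t - p)%R); first by rewrite subr_gt0.
  by move=> n; have /andP[_ a2] := aP n; rewrite /=; move: (n.+1%:R^-1)%R a2 => e a2; lra.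
- apply: (side _ (q - t)%R); first by rewrite subr_gt0.
  move=> n; have /andP[_ b2] := bP n; rewrite /= rmorphN/=.
  by move: (n.+1%:R^-1)%R b2 => e b2; lra.
Unshelve. all: by end_near. Qed.

Lemma integrable_itv_rcutoff_oo I (p q : R) : measurable_fun setT I ->
  (forall c, leb.-integrable setT (fun t => (rcutoff c t)%:E * I t)) ->
  leb.-integrable `]p, q[ I.
Proof.
move=> mI iI; pose n := (Num.trunc (`|p| + `|q|)).+1.
apply: (@integrableS _ RR R leb `[(- n%:R)%R, n%:R%R]) => //.
  move=> t; rewrite /= !in_itv/= => /andP[pt tq].
  have nlt : (`|p| + `|q| < n%:R)%R by exact: truncnS_gt.
  have p1 := ler_norm (- p)%R; have q1 := ler_norm q; rewrite normrN in p1.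
  have p0 := normr_ge0 p; have q0 := normr_ge0 q.
  by apply/andP; split; lra.
exact: integrable_itv_of_rcutoff.
Qed.

(** Dominated convergence replaces the cut-offs by the indicator function of the interval; the
    integrand without cut-off dominates, cut-offs being at most [1]. *)
Lemma integral_itv_rcutoff I J (p q : R) : measurable_fun setT I -> measurable_fun setT J ->
  (forall c, leb.-integrable setT (fun t => (rcutoff c t)%:E * I t)) ->
  (forall c, leb.-integrable setT (fun t => (rcutoff c t)%:E * J t)) ->
  (forall c, \int[leb]_t ((rcutoff c t)%:E * I t) = \int[leb]_t ((rcutoff c t)%:E * J t)) ->
  (p < q)%R -> \int[leb]_(t in `]p, q[) I t = \int[leb]_(t in `]p, q[) J t.
Proof.
move=> mI mJ iI iJ IJ pq; have [c [c0 c1]] := rcutoff_cvg_seq pq.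
have lim (K : R -> \bar R) : measurable_fun setT K ->
    (forall c, leb.-integrable setT (fun t => (rcutoff c t)%:E * K t)) ->
    (\int[leb]_t ((rcutoff (c n) t)%:E * K t) @[n --> \oo] --> \int[leb]_(t in `]p, q[) K t).
  move=> mK iK.
  have iKpq : leb.-integrable `]p, q[ K by exact: integrable_itv_rcutoff_oo.
  have -> : (fun n => \int[leb]_t ((rcutoff (c n) t)%:E * K t)) =
      (fun n => \int[leb]_(t in `]p, q[) ((rcutoff (c n) t)%:E * K t)).
    apply/funext => n; rewrite [RHS]integral_mkcond; apply: eq_integral => t _.
    rewrite patchE; case: ifPn => // /negP; rewrite inE/= in_itv/= => /c0 ->.
    by rewrite mul0e.
  have [] := @dominated_convergence _ RR R leb `]p, q[%classic (measurable_itv _)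
    (fun n t => (rcutoff (c n) t)%:E * K t) K (abse \o K).
  - move=> n; apply: emeasurable_funM.
      by apply/measurable_EFinP; apply: measurable_funTS; exact: measurable_rcutoff.
    exact: measurable_funTS.
  - exact: measurable_funTS.
  - have := @integrable_ae _ RR R leb _ (measurable_itv _) K iKpq.
    apply: ae_imply => t Kt pqt; have {}Kt := Kt pqt.
    move: pqt; rewrite /= in_itv/= => /c1 t1.
    rewrite -[X in _ --> X](mul1e (K t)); apply: cvgeMr => //.
    by apply: cvg_EFin; [exact: nearW|exact: t1].
  - exact: integrable_abse.
  - apply: aeW => t n _ /=; rewrite abseM abse_EFin -[leRHS]mul1e lee_wpmul2r//.
    by rewrite lee_fin ger0_norm ?rcutoff_ge0 ?rcutoff_le1.
  - by [].
have lI := lim _ mI iI; have lJ := lim _ mJ iJ.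
rewrite -(cvg_lim _ lI)// -(cvg_lim _ lJ)//; congr (limn _).
by apply/funext => n; exact: IJ.
Qed.

Lemma integrable_EFin_fine (A : set R) I : measurable A -> leb.-integrable A I ->
  leb.-integrable A (EFin \o fine \o I).
Proof.
move=> mA iI; have mI := measurable_int leb iI.
apply: (@le_integrable _ RR R leb A mA _ I) => //.
  by apply/measurable_EFinP; apply: measurableT_comp => //; exact: measurable_fine.
by move=> t _ /=; case: (I t) => [r| |]//=; rewrite leey.
Qed.

Lemma nicely_shrinking_ball (x : R) : nicely_shrinking x (fun n => ball x n.+1%:R^-1).
Proof.
split; first by move=> n; exact: measurable_ball.
have r0 n : (0 < n.+1%:R^-1 :> R)%R by rewrite invr_gt0.
exists (1%R, fun n => PosNum (r0 n)); split => //=.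
- exact: (@cvg_harmonic R).
- by move=> n t.
- by move=> n; rewrite mul1e.
Qed.

(** Lebesgue differentiation: at almost every point the value is a limit of means over intervals,
    all of which vanish. *)
Lemma ae_eq0_of_itv D : measurable_fun setT D ->
  (forall n : nat, leb.-integrable `[(- n%:R)%R, n%:R%R] (EFin \o D)) ->
  (forall p q : R, (p < q)%R -> \int[leb]_(t in `]p, q[) (D t)%:E = 0) ->
  {ae leb, forall t, D t = 0%R}.
Proof.
move=> mD iD D0.
have locD : locally_integrable setT D.
  split=> //; first exact: openT.
  move=> K _ cK; have [M [_ MK]] := compact_bounded cK.
  pose n := (Num.trunc `|M|).+1.
  have nM : (M < n%:R)%R by apply: le_lt_trans (truncnS_gt _); exact: ler_norm.
  have /integrableP[_] := iD n; apply: le_lt_trans.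
  apply: ge0_subset_integral => //=.
  - exact: compact_measurable.
  - by apply/measurable_EFinP; apply: measurableT_comp => //; exact: measurable_funTS.
  - by move=> t Kt; rewrite /= in_itv/= -ler_norml; exact: MK.
have := lebesgue_differentiation locD; apply: ae_imply => x Dx.
have := @nice_lebesgue_differentiation R _ nicely_shrinking_ball D locD x Dx.
rewrite (_ : (fun _ => _) = cst 0) => [/(cvg_lim (@ereal_hausdorff R))|].
  by rewrite lim_cst// => -[].
apply/funext => n; rewrite ball_itv D0 ?mule0//.
have : (0 < n.+1%:R^-1 :> R)%R by rewrite invr_gt0.
by move: (n.+1%:R^-1)%R => e e0; lra.
Qed.

(** [I] and [J] stand for inner iterated integrals, hence the extended values. Integrability against
    cut-offs is assumed for [J]; the equality of integrals transfers it to [I]. *)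
Lemma ae_eq_of_rcutoff I J : measurable_fun setT I -> measurable_fun setT J ->
  (forall c, leb.-integrable setT (fun t => (rcutoff c t)%:E * J t)) ->
  (forall c, \int[leb]_t ((rcutoff c t)%:E * I t) = \int[leb]_t ((rcutoff c t)%:E * J t)) ->
  {ae leb, forall t, I t = J t}.
Proof.
move=> mI mJ iJ IJ.
have iI c : leb.-integrable setT (fun t => (rcutoff c t)%:E * I t).
  apply: fin_num_integral_integrable.
    by apply: emeasurable_funM => //; apply/measurable_EFinP; exact: measurable_rcutoff.
  by rewrite IJ; exact: integrable_fin_num.
pose D t := (fine (I t) - fine (J t))%R.
have mfine (K : R -> \bar R) : measurable_fun setT K -> measurable_fun setT (fine \o K).
  by move=> mK; apply: measurableT_comp => //; exact: measurable_fine.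
have finI := ae_fin_of_rcutoff mI iI.
have finJ := ae_fin_of_rcutoff mJ iJ.
have intf (K : R -> \bar R) (A : set R) : measurable A -> measurable_fun setT K ->
    {ae leb, forall t, K t \is a fin_num} ->
    \int[leb]_(t in A) (fine (K t))%:E = \int[leb]_(t in A) K t.
  move=> mA mK fK; apply: (@ae_eq_integral _ RR R leb A _ _ mA).
  - by apply/measurable_EFinP; apply: measurable_funTS; exact: mfine.
  - exact: measurable_funTS.
  - by apply: ae_imply fK => t Kt _; rewrite fineK.
have D0 : {ae leb, forall t, D t = 0%R}.
  apply: ae_eq0_of_itv.
  - by apply: measurable_funB; exact: mfine.
  - move=> n; rewrite (_ : EFin \o D =
        (fun t => (EFin \o fine \o I) t - (EFin \o fine \o J) t))//.
    by apply: integrableB => //; apply: integrable_EFin_fine => //;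
      exact: integrable_itv_of_rcutoff.
  - move=> p q pq; have mpq : measurable (`]p, q[%classic : set R) by exact: measurable_itv.
    under eq_integral do rewrite EFinB.
    rewrite (@integralB _ RR R leb _ mpq (EFin \o fine \o I) (EFin \o fine \o J));
      try by apply: integrable_EFin_fine => //; exact: integrable_itv_rcutoff_oo.
    rewrite (intf I)// (intf J)// (integral_itv_rcutoff mI mJ iI iJ IJ pq) subee//.
    by apply: integrable_fin_num => //; exact: integrable_itv_rcutoff_oo.
have := ae_conj D0 (ae_conj finI finJ); apply: ae_imply => t [Dt [It Jt]].
rewrite -(fineK It) -(fineK Jt); congr EFin; apply/eqP.
by rewrite -subr_eq0; apply/eqP.
Qed.

End Fundamental.

(** * A weak derivative of order zero agrees with the function almost everywhere *)

Section WeakUniqueness.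
Context {R : realType} {d : nat}.
Local Notation X := (rVb R d).
Local Notation leb := (@lebesgue_measure R).
Local Notation RR := (measurableTypeR R).
Local Notation DT := (fun _ : nat => [set: R]).
Local Open Scope ereal_scope.
Implicit Types (f g h : 'rV[R]_d -> R) (x y : 'rV[R]_d) (c : {ffun 'I_d -> rat * rat * nat}).

Lemma mDTP k : measurable (DT k). Proof. exact: measurableT. Qed.

Lemma le_abse_giint k (F : 'rV[R]_d -> \bar R) x :
  measurable_fun setT (F : X -> \bar R) ->
  `|giint DT k F x| <= giint DT k (abse \o F) x.
Proof.
move=> mF; elim: k x => // k IH x.
have mF1 : measurable_fun setT (abse \o F : X -> \bar R) by exact: measurableT_comp.
apply: (@le_trans _ _ (\int[leb]_t `|giint DT k F (setc x k t)|)).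
  by apply: (@le_abse_integral _ RR R leb _ _ measurableT); exact: (measurable_giint_setcS mDTP).
apply: (@ge0_le_integral _ RR R leb _ measurableT) => //.
- by apply: measurableT_comp => //; exact: (measurable_giint_setcS mDTP).
- exact: (measurable_giint_setcS mDTP).
Qed.

(** The constant [1] from coordinate [k] on leaves these variables free for the induction over the
    iterated integral. *)
Definition phith (k : nat) c (i : 'I_d) : R -> R := if (i < k)%N then rcutoff (c i) else cst 1%R.

Definition phi (k : nat) c : 'rV[R]_d -> R := tensor (phith k c).

Lemma smc_phith k c i : smc (phith k c i).
Proof. by rewrite /phith; case: ifP => _; [exact: smc_rcutoff|exact: smc_cst]. Qed.

Lemma measurable_phi k c : measurable_fun setT (phi k c : X -> R).
Proof. by apply: measurable_tensor => i; apply: smc_continuous; exact: smc_phith. Qed.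

Lemma phi_ge0 k c y : (0 <= phi k c y)%R.
Proof. by apply: prodr_ge0 => i _; rewrite /phith; case: ifP => // _; exact: rcutoff_ge0. Qed.

Lemma phi_le1 k c y : (phi k c y <= 1)%R.
Proof.
apply: prodr_ile1 => i _; rewrite /phith; case: ifP => // _.
  by rewrite rcutoff_ge0 rcutoff_le1.
by rewrite /cst ler01 lexx.
Qed.

Lemma phiS k (kd : (k < d)%N) c p y :
  phi k.+1 [ffun i => if i == Ordinal kd then p else c i] y =
  (rcutoff p (y ord0 (Ordinal kd)) * phi k c y)%R.
Proof.
rewrite /phi /tensor (bigD1 (Ordinal kd))//= [in RHS](bigD1 (Ordinal kd))//=.
have -> : phith k.+1 [ffun i => if i == Ordinal kd then p else c i] (Ordinal kd) = rcutoff p.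
  by rewrite /phith/= ltnSn ffunE eqxx.
have -> : phith k c (Ordinal kd) = cst 1%R by rewrite /phith/= ltnn.
rewrite mul1r; congr (_ * _)%R.
apply: eq_bigr => j jk; rewrite /phith ffunE (negPf jk) ltnS leq_eqVlt.
by rewrite (_ : (j == k :> nat) = false)//; apply: contraNF jk => /eqP jk; apply/eqP/val_inj.
Qed.

Lemma giint_phiS k (kd : (k < d)%N) c p h x t : measurable_fun setT (h : X -> R) ->
  giint DT k (fun y => (h y * phi k.+1 [ffun i => if i == Ordinal kd then p else c i] y)%:E)
    (setc x k t) =
  (rcutoff p t)%:E * giint DT k (fun y => (h y * phi k c y)%:E) (setc x k t).
Proof.
move=> mh; rewrite -(giint_nnegZl mDTP); last exact: rcutoff_ge0; last first.
  by apply/measurable_EFinP; apply: measurable_funM => //; exact: measurable_phi.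
apply: giint_ext => y yx _; rewrite phiS yx// (_ : setc x k t ord0 (Ordinal kd) = t).
  by rewrite -EFinM mulrCA.
by rewrite mxE eqxx.
Qed.

Lemma integral_rcutoff_lty p : \int[leb]_t (rcutoff p t)%:E < +oo.
Proof.
apply: (@le_lt_trans _ _ (\int[leb]_(t in `](ratr p.1.1)%R, (ratr p.1.2)%R[) (cst 1 t))).
  rewrite [leRHS]integral_mkcond; apply: (@ge0_le_integral _ RR R leb _ measurableT) => //.
  - by move=> t _; rewrite lee_fin rcutoff_ge0.
  - by apply/measurable_EFinP; exact: measurable_rcutoff.
  - by apply/(measurable_restrictT _ (measurable_itv _)).
  - move=> t _; rewrite patchE; case: ifPn => [_|/negP]; first by rewrite lee_fin rcutoff_le1.
    by rewrite inE/= in_itv/= => tp; rewrite /rcutoff cutoff_eq0.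
rewrite integral_cst//= mul1e lebesgue_measure_itv/=.
by case: ifP => _; rewrite ?ltry// -EFinB ltry.
Qed.

Lemma giint_phi_fin k c : (k <= d)%N ->
  exists r : R, forall x, giint DT k (fun y => (phi k c y)%:E) x = r%:E.
Proof.
elim: k => [_|k IH kd].
  exists 1%R => x /=; congr EFin; rewrite /phi /tensor; apply: big1 => i _.
  by rewrite /phith ltn0.
have [r rE] := IH (ltnW kd).
exists (fine (\int[leb]_t (rcutoff (c (Ordinal kd)) t)%:E) * r)%R => x.
transitivity (\int[leb]_t ((rcutoff (c (Ordinal kd)) t)%:E * r%:E)).
  apply: eq_integral => t _; rewrite -(rE (setc x k t)).
  have := @giint_phiS k kd c (c (Ordinal kd)) (cst 1%R) x t (measurable_cst _).
  rewrite (_ : [ffun i => _] = c) => [H|]; last first.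
    by apply/ffunP => i; rewrite ffunE; case: eqP => [->|].
  apply: (etrans (etrans _ H)); first by apply: eq_giint => y; rewrite /cst mul1r.
  by congr (_ * _); apply: eq_giint => y; rewrite /cst mul1r.
have i0 : leb.-integrable setT (fun t => (rcutoff (c (Ordinal kd)) t)%:E).
  apply/integrableP; split; first by apply/measurable_EFinP; exact: measurable_rcutoff.
  under eq_integral => t _ do rewrite abse_EFin ger0_norm ?rcutoff_ge0//.
  exact: integral_rcutoff_lty.
rewrite (@integralZr _ RR R leb _ measurableT _ i0) EFinM fineK//.
exact: (@integrable_fin_num _ RR R leb).
Qed.

(** For fixed inner cut-offs the one-dimensional result applies to the inner integrals as functions
    of the outermost variable, and the hypotheses hold again on almost every slice. The bound on
    [|g|] makes the inner integrals of [g] integrable against cut-offs and is itself inherited by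
    almost every slice. *)
Lemma giint_neq_eq0 k f g x : (k <= d)%N ->
  measurable_fun setT (f : X -> R) -> measurable_fun setT (g : X -> R) ->
  (forall c, giint DT k (fun y => (f y * phi k c y)%:E) x =
             giint DT k (fun y => (g y * phi k c y)%:E) x) ->
  (forall c, giint DT k (fun y => (`|g y| * phi k c y)%:E) x < +oo) ->
  giint DT k (fun y => (\1_[set y : X | f y != g y] y)%:E) x = 0.
Proof.
move=> + mf mg; have mE := measurable_neq_rV mf mg.
have mfp h j c : measurable_fun setT (h : X -> R) ->
    measurable_fun setT (fun y : X => (h y * phi j c y)%:E).
  by move=> mh; apply/measurable_EFinP; apply: measurable_funM => //; exact: measurable_phi.
have mg1 : measurable_fun setT (fun y : X => `|g y|%R) by exact: measurableT_comp.
elim: k x => [x _ fg _ /=|k IH x kd fg gfin].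
  (* For [k = 0] the product of cut-offs is [1], so any parameters do. *)
  have := fg [ffun=> (0%R, 0%R, 0%N)]; rewrite /= /phi /tensor big1 ?mulr1 => [[fgx]|i _].
    by rewrite indicE memNset//= fgx eqxx.
  by rewrite /phith ltn0.
pose c' c p : {ffun 'I_d -> rat * rat * nat} := [ffun i => if i == Ordinal kd then p else c i].
pose I c t := giint DT k (fun y => (f y * phi k c y)%:E) (setc x k t).
pose J c t := giint DT k (fun y => (g y * phi k c y)%:E) (setc x k t).
pose N c t := giint DT k (fun y => (`|g y| * phi k c y)%:E) (setc x k t).
have mI c : measurable_fun setT (I c) by apply: (measurable_giint_setc mDTP); exact: mfp.
have mJ c : measurable_fun setT (J c) by apply: (measurable_giint_setc mDTP); exact: mfp.
have mN c : measurable_fun setT (N c).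
  by apply: (measurable_giint_setc mDTP); exact: (mfp (fun y => `|g y|%R)).
have N0 c t : 0 <= N c t by apply: giint_ge0 => y; rewrite lee_fin mulr_ge0 ?phi_ge0.
have mprod (K : R -> \bar R) p : measurable_fun setT K ->
    measurable_fun setT (fun t : R => (rcutoff p t)%:E * K t).
  move=> mK; apply: emeasurable_funM; last exact: mK.
  by apply/measurable_EFinP; exact: measurable_rcutoff.
have iN c p : leb.-integrable setT (fun t => (rcutoff p t)%:E * N c t).
  apply/integrableP; split.
    exact: (mprod (N c)).
  apply: le_lt_trans (gfin (c' c p)); rewrite le_eqVlt; apply/orP; left; apply/eqP.
  apply: eq_integral => t _; rewrite gee0_abs ?mule_ge0 ?lee_fin ?rcutoff_ge0//.
  exact: (esym (@giint_phiS k kd c p (fun y => `|g y|%R) x t mg1)).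
have NJ c t : `|J c t| <= N c t.
  apply: (le_trans (le_abse_giint _ _ (mfp g k c mg))); rewrite le_eqVlt; apply/orP; left.
  by apply/eqP/eq_giint => y /=; rewrite normrM (ger0_norm (phi_ge0 _ _ _)).
have iJ c p : leb.-integrable setT (fun t => (rcutoff p t)%:E * J c t).
  apply: (@le_integrable _ RR R leb _ measurableT _ (fun t => (rcutoff p t)%:E * N c t)) => //.
    exact: (mprod (J c)).
  by move=> t _; rewrite !abseM lee_wpmul2l// (gee0_abs (N0 c t)).
have IJ c p : \int[leb]_t ((rcutoff p t)%:E * I c t) = \int[leb]_t ((rcutoff p t)%:E * J c t).
  apply: (etrans _ (etrans (fg (c' c p)) _)); apply: eq_integral => t _.
    exact: (esym (@giint_phiS k kd c p f x t mf)).
  exact: (@giint_phiS k kd c p g x t mg).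
have ae1 c : {ae leb, forall t, I c t = J c t /\ N c t \is a fin_num}.
  by apply: ae_conj; [exact: ae_eq_of_rcutoff|exact: ae_fin_of_rcutoff].
(* One null set for all [c] at once: the parameters are countable and enumerated by [pickle]. *)
have ae2 : {ae leb, forall t, forall c, I c t = J c t /\ N c t \is a fin_num}.
  pose P n t := if unpickle n is Some c then I c t = J c t /\ N c t \is a fin_num else True.
  have aP n : {ae leb, forall t, P n t}.
    by rewrite /P; case: unpickle => [c|]; [exact: ae1|exact: aeW].
  have := @ae_foralln _ RR R leb P aP; apply: ae_imply => t Pt c.
  by have := Pt (pickle c); rewrite /P pickleK.
transitivity (\int[leb]_(t in [set: R]) (cst 0 t : \bar R)); last exact: integral0.
apply: (@ae_eq_integral _ RR R leb setT _ _ measurableT) => //.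
  exact: (measurable_giint_setcS mDTP _ _ (measurable_indic_EFin mE)).
apply: ae_imply ae2 => t Ht _; apply: IH; first exact: ltnW.
- by move=> c; have [] := Ht c.
- by move=> c; have [_] := Ht c; rewrite ge0_fin_numE.
Qed.

Lemma weak_set0_ae_eq f g : measurable_d f -> measurable_d g -> L2sq g < +oo ->
  weak_mixD finset.set0 f g -> gmeas mDTP [set y : X | f y != g y] = 0.
Proof.
move=> /measurable_dP mf /measurable_dP mg g2 wfg; apply: giint_neq_eq0 => // c.
  have sth i : smc (phith d c i) by exact: smc_phith.
  have t0 : test_fun (phi d c).
    apply: (@tensor_test_fun _ _ _ (fun i => ratr (c i).1.1) (fun i => ratr (c i).1.2)) => //.
    move=> j u nu; rewrite /phith ltn_ord; apply: cutoff_eq0 => //.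
    by apply: contra_not nu => /andP[/ltW -> /ltW ->].
  have := wfg _ t0; rewrite pD_mixseq// /integral_d !iint_giint.
  rewrite (_ : tensor _ = phi d c)//; congr tensor; apply/funext => i.
  by rewrite finset.in_set0.
have [r rE] := @giint_phi_fin d c (leqnn d).
have mg2 : measurable_fun setT (fun y : X => (g y ^+ 2)%:E).
  by apply/measurable_EFinP; exact: measurable_funX.
have mp : measurable_fun setT (fun y : X => (phi d c y)%:E).
  by apply/measurable_EFinP; exact: measurable_phi.
(* Since [phi] lies between [0] and [1], the product [|g| * phi] is at most [g ^+ 2 + phi], and both
   terms have a finite integral. *)
apply: (@le_lt_trans _ _ (giint DT d (fun y => (g y ^+ 2)%:E + (phi d c y)%:E) 0)).
  apply: (le_giint mDTP).
  - apply/measurable_EFinP; apply: measurable_funM; last exact: measurable_phi.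
    exact: measurableT_comp.
  - exact: emeasurable_funD.
  - by move=> y; rewrite lee_fin mulr_ge0 ?phi_ge0.
  - move=> y; rewrite -EFinD lee_fin -(real_normK (num_real (g y))).
    have := phi_ge0 d c y; have := phi_le1 d c y; have := normr_ge0 (g y).
    move: (phi d c y) (`|g y|%R) => p G; nra.
rewrite (ge0_giintD mDTP)// => [|y|y]; rewrite ?lee_fin ?sqr_ge0 ?phi_ge0//.
rewrite rE lte_add_pinfty ?ltry//.
by move: g2; rewrite /L2sq /integral_d iint_giint.
Qed.

End WeakUniqueness.

(** * The one-dimensional kernels *)

Section Trigonometry.
Context {R : realType}.
Implicit Types x y : R.

Lemma cosDnpi x n : cos (x + n%:R * pi) = (-1) ^+ n * cos x.
Proof.
elim: n => [|n IH]; first by rewrite mul0r addr0 expr0 mul1r.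
by rewrite -natr1 mulrDl mul1r addrA cosDpi IH exprS mulN1r mulNr.
Qed.

Lemma sinDnpi x n : sin (x + n%:R * pi) = (-1) ^+ n * sin x.
Proof.
elim: n => [|n IH]; first by rewrite mul0r addr0 expr0 mul1r.
by rewrite -natr1 mulrDl mul1r addrA sinDpi IH exprS mulN1r mulNr.
Qed.

Lemma norm_sin_le x : `|sin x| <= `|x|.
Proof.
wlog x0 : x / 0 <= x.
  have [x0|x0] := leP 0 x; first by apply.
  by move=> /(_ (- x)); rewrite sinN !normrN; apply; rewrite oppr_ge0 ltW.
have [c _] : exists2 c : R, c \in `[0, x] & sin x - sin 0 = cos c * (x - 0).
  apply: (@MVT_segment R sin cos) => //.
  by apply: continuous_subspaceT; exact: continuous_sin.
rewrite sin0 !subr0 => ->; rewrite normrM -[leRHS]mul1r ler_wpM2r//.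
exact: cos_max.
Qed.

Lemma onem_cos_le x : `|1 - cos x| <= x ^+ 2.
Proof.
have -> : 1 - cos x = 2 * sin (x / 2) ^+ 2.
  rewrite [in LHS](_ : x = (x / 2) *+ 2); last by rewrite -mulr_natr divfK// pnatr_eq0.
  by rewrite cos_mulr2n cos2sin2; ring.
rewrite ger0_norm; last by rewrite mulr_ge0// sqr_ge0.
have := norm_sin_le (x / 2); rewrite -ler_sqr ?nnegrE//.
rewrite !real_normK ?num_real//; have := sqr_ge0 x; nra.
Qed.

Lemma is_derive_cosl (c x : R) : is_derive x 1 (fun v => cos (c * v)) (- c * sin (c * x)).
Proof.
have := @is_derive_affine R c 0 x (- sin (c * x + 0)) cos (is_derive_cos _).
rewrite (_ : (fun u => cos (c * u + 0)) = (fun v => cos (c * v))).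
  by rewrite addr0 mulrN mulNr.
by apply/funext => u; rewrite addr0.
Qed.

Lemma is_derive_sinl (c x : R) : is_derive x 1 (fun v => sin (c * v)) (c * cos (c * x)).
Proof.
have := @is_derive_affine R c 0 x (cos (c * x + 0)) sin (is_derive_sin _).
rewrite (_ : (fun u => sin (c * u + 0)) = (fun v => sin (c * v))).
  by rewrite addr0.
by apply/funext => u; rewrite addr0.
Qed.

End Trigonometry.

(* On [0, 1] the rescaled cosine is [kA'' + kQ], where [kA] vanishes to second
   order at both end points and both [kA] and [kQ] are bounded independently of [n]. *)
Section Kernel.
Context {R : realType}.
Implicit Types (n : nat) (v u a s : R).

Definition par n : R := (odd n)%:R.
(* The junk value [kap 0 = 0] makes the case [n = 0] uniform. *)
Definition kap n : R := (1 + n%:R) ^+ 2 / n%:R ^+ 2.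
Definition kA n v : R := kap n / pi ^+ 2 * (cos (pi * par n * v) - cos (pi * n%:R * v)).
Definition kA1 n v : R :=
  kap n / pi * (n%:R * sin (pi * n%:R * v) - par n * sin (pi * par n * v)).
Definition kA2 n v : R :=
  kap n * (n%:R ^+ 2 * cos (pi * n%:R * v) - par n ^+ 2 * cos (pi * par n * v)).
(** For [n > 0] this compensates the comparison cosine left in [kA2]; for [n = 0], where [kA]
    vanishes identically, it is the whole cosine, namely [1]. *)
Definition kQ n v : R := kap n * par n ^+ 2 * cos (pi * par n * v) + (n == 0%N)%:R.

Let pin0 : (pi : R) != 0. Proof. by rewrite gt_eqF// pi_gt0. Qed.

Lemma kap0 : kap 0 = 0. Proof. by rewrite /kap expr0n/= invr0 mulr0. Qed.

Lemma kA2DkQ n v : kA2 n v + kQ n v = (1 + n%:R) ^+ 2 * cos (pi * n%:R * v).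
Proof.
rewrite /kA2 /kQ; case: n => [|n].
  have -> : cos (pi * 0%:R * v) = 1 :> R by rewrite mulr0 mul0r cos0.
  by rewrite kap0 !mul0r !add0r addr0 expr1n mul1r.
have n0 : n.+1%:R != 0 :> R by rewrite pnatr_eq0.
by rewrite /kap addr0; field.
Qed.

Lemma kap_ge0 n : 0 <= kap n.
Proof. by rewrite divr_ge0// sqr_ge0. Qed.

(** [1 + n <= 2 * n] as soon as [n >= 1]: the origin of the [4] in the estimates. *)
Lemma kap_le4 n : kap n <= 4.
Proof.
case: n => [|n]; first by rewrite kap0.
rewrite /kap ler_pdivrMr ?exprn_gt0//.
have : 1 <= n.+1%:R :> R by rewrite ler1n.
by move: (n.+1%:R) => y y1; nra.
Qed.

Lemma par_ge0 n : 0 <= par n. Proof. exact: ler0n. Qed.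

Lemma par_le1 n : par n <= 1. Proof. by rewrite /par lern1; case: odd. Qed.

(** The two cosines contribute at most [2], which is absorbed by [pi ^+ 2]. *)
Lemma kA_le4 n v : `|kA n v| <= 4.
Proof.
rewrite /kA normrM ger0_norm ?divr_ge0 ?kap_ge0 ?sqr_ge0//.
have k0 := kap_ge0 n; have k4 := kap_le4 n.
have H : `|cos (pi * par n * v) - cos (pi * n%:R * v)| <= 2.
  by rewrite (le_trans (ler_normB _ _))// -[leRHS]/(1 + 1) lerD// cos_max.
have p4 : 2 <= (pi : R) ^+ 2 by have := pi_ge2 R; move: (pi : R) => p; nra.
rewrite mulrAC ler_pdivrMr ?exprn_gt0 ?pi_gt0//.
by apply: ler_pM => //; exact: le_trans H p4.
Qed.

Lemma kQ_le4 n v : `|kQ n v| <= 4.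
Proof.
rewrite /kQ; case: n => [|n].
  by rewrite kap0 !mul0r add0r normr1 ler1n.
rewrite addr0; have := kap_ge0 n.+1; have := kap_le4 n.+1; move: (kap _) => k k4 k0.
have := par_ge0 n.+1; have := par_le1 n.+1; move: (par _) => p p1 p0.
rewrite normrM -[leRHS]mulr1; apply: ler_pM => //; last exact: cos_max.
by rewrite ger0_norm ?mulr_ge0 ?sqr_ge0//; nra.
Qed.

Lemma is_derive_kA n v : is_derive v 1 (kA n) (kA1 n v).
Proof.
have := is_derive_mul (is_derive_cst (kap n / pi ^+ 2) v 1)
  (is_derive_add (is_derive_cosl (pi * par n) v)
    (is_derive_mul (is_derive_cst (-1 : R) v 1) (is_derive_cosl (pi * n%:R) v))).
rewrite [X in is_derive _ _ X _ -> _](_ : _ = kA n); last first.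
  by apply/funext => u; rewrite /kA /cst mulN1r.
move=> H; apply: (is_derive_eq H) => {H}; rewrite /kA1 /cst; have pp := pin0.
by move: (kap n) pp; move: (pi : R) => p k p0; field.
Qed.

Lemma is_derive_kA1 n v : is_derive v 1 (kA1 n) (kA2 n v).
Proof.
have := is_derive_mul (is_derive_cst (kap n / pi) v 1)
  (is_derive_add (is_derive_mul (is_derive_cst (n%:R : R) v 1) (is_derive_sinl (pi * n%:R) v))
    (is_derive_mul (is_derive_cst (- par n) v 1) (is_derive_sinl (pi * par n) v))).
rewrite [X in is_derive _ _ X _ -> _](_ : _ = kA1 n); last first.
  by apply/funext => u; rewrite /kA1 /cst mulNr.
move=> H; apply: (is_derive_eq H) => {H}; rewrite /kA2 /cst; have pp := pin0.
by move: (kap n) pp; move: (pi : R) => p k p0; field.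
Qed.

Lemma cos_reflect n v : cos (pi * n%:R * (1 - v)) = (-1) ^+ n * cos (pi * n%:R * v).
Proof. by rewrite -(cosN (pi * n%:R * v)) -cosDnpi; congr cos; ring. Qed.

Lemma sin_reflect n v : sin (pi * n%:R * (1 - v)) = - ((-1) ^+ n * sin (pi * n%:R * v)).
Proof.
rewrite (_ : pi * n%:R * (1 - v) = - (pi * n%:R * v) + n%:R * pi); last by ring.
by rewrite sinDnpi sinN mulrN.
Qed.

(** [par n] has the parity of [n], so both cosines pick up the same sign; this carries the bounds at
    [0] over to [1]. *)
Lemma kA_reflect n v : kA n (1 - v) = (-1) ^+ n * kA n v.
Proof. by rewrite /kA !cos_reflect signr_odd; ring. Qed.

Lemma kA1_reflect n v : kA1 n (1 - v) = - ((-1) ^+ n * kA1 n v).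
Proof. by rewrite /kA1 !sin_reflect signr_odd; ring. Qed.

(** Constant of the Taylor bounds at the end points. Its growth in [n] is harmless, as it enters
    dominating functions only. *)
Definition kK n : R := kap n * (n%:R ^+ 2 + par n ^+ 2).

Lemma kK_ge0 n : 0 <= kK n.
Proof. by rewrite mulr_ge0 ?kap_ge0// addr_ge0// sqr_ge0. Qed.

Lemma kA_bound n v : `|kA n v| <= kK n * v ^+ 2.
Proof.
rewrite /kA /kK; move: (kap n) (kap_ge0 n) => k k0.
rewrite normrM ger0_norm ?divr_ge0 ?sqr_ge0//.
rewrite mulrAC ler_pdivrMr ?exprn_gt0 ?pi_gt0// -!mulrA ler_wpM2l//.
rewrite (_ : cos _ - cos _ = (1 - cos (pi * (n%:R * v))) - (1 - cos (pi * (par n * v))));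
  last by ring.
apply: (le_trans (ler_normB _ _)); apply: (le_trans (lerD (onem_cos_le _) (onem_cos_le _))).
by rewrite le_eqVlt; apply/orP; left; apply/eqP; ring.
Qed.

Lemma kA1_bound n v : `|kA1 n v| <= kK n * `|v|.
Proof.
have p0 := pi_gt0 R.
rewrite /kA1 /kK; move: (kap n) (kap_ge0 n) => k k0.
rewrite normrM ger0_norm ?divr_ge0 ?(ltW p0)//.
rewrite mulrAC ler_pdivrMr// -!mulrA ler_wpM2l//.
apply: (le_trans (ler_normB _ _)); rewrite !normrM (ger0_norm (par_ge0 n)) (ger0_norm (ler0n _ n)).
have h1 := norm_sin_le (pi * (n%:R * v)); have h2 := norm_sin_le (pi * (par n * v)).
rewrite !normrM (ger0_norm (ltW p0)) (ger0_norm (ler0n _ n)) in h1.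
rewrite !normrM (ger0_norm (ltW p0)) (ger0_norm (par_ge0 n)) in h2.
apply: (le_trans (lerD (ler_wpM2l (ler0n _ n) h1) (ler_wpM2l (par_ge0 n) h2))).
by rewrite le_eqVlt; apply/orP; left; apply/eqP; ring.
Qed.

Lemma kA2_bound n v : `|kA2 n v| <= kK n.
Proof.
rewrite /kA2 normrM (ger0_norm (kap_ge0 n)) ler_wpM2l ?kap_ge0//.
have H (x y : R) : 0 <= x -> `|x * cos y| <= x.
  by move=> x0; rewrite normrM (ger0_norm x0) ler_piMr// cos_max.
by apply: (le_trans (ler_normB _ _)); apply: lerD; apply: H; exact: sqr_ge0.
Qed.

Lemma norm_sign_mul n (x : R) : `|(-1) ^+ n * x| = `|x|.
Proof. by rewrite normrM normrX normrN1 expr1n mul1r. Qed.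

Lemma kA_bound' n v : `|kA n v| <= kK n * (1 - v) ^+ 2.
Proof. by apply: le_trans (kA_bound n (1 - v)); rewrite kA_reflect norm_sign_mul. Qed.

Lemma kA1_bound' n v : `|kA1 n v| <= kK n * `|1 - v|.
Proof. by apply: le_trans (kA1_bound n (1 - v)); rewrite kA1_reflect normrN norm_sign_mul. Qed.

(** * Kernels with cut-off: bounds uniform in the scale, and limits *)

Definition thA n a s u : R := cutoff a (a + 1) s u * kA n (u - a).
Definition thQ n a s u : R := cutoff a (a + 1) s u * kQ n (u - a).

(** [E1] and [E2] are the first two derivatives of [flat 1]; [P2] is what remains of the polynomial
    of [E2] after splitting off the ['X^2] that a factor [y ^+ 2] cancels. *)
Definition E1 : R -> R := flat 'X^2.
Definition P2 : {poly R} := 'X * ('X - 2%:P).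
Definition E2 : R -> R := flat ('X^2 * P2).

Lemma is_derive_E (y : R) : is_derive y 1 (flat 1) (E1 y).
Proof.
by have := is_derive_flat 1 y; rewrite -{2}polyC1 derivC subr0 mulr1.
Qed.

Lemma is_derive_E1 (y : R) : is_derive y 1 E1 (E2 y).
Proof.
have := is_derive_flat 'X^2 y; rewrite derivXn/= (_ : 'X^2 - 'X *+ 2 = P2)//.
by rewrite /P2 mulrBr -expr2 mulrC mul_polyC -scaler_nat.
Qed.

Lemma E1E y : y * E1 y = flat 'X y.
Proof. by rewrite [RHS]flatXM -expr2. Qed.

Lemma E2E y : y ^+ 2 * E2 y = flat P2 y.
Proof. by rewrite [RHS]flatXM [in RHS]flatXM mulrA -expr2 mulrA -expr2. Qed.

(** The product rule written out. [w] decreases in [u], whence the minus signs. This form makes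
    sense also where [v] or [w] vanishes. *)
Definition thA2 n a s u : R :=
  let v := u - a in let w := a + 1 - u in
  (s ^+ 2 * E2 (s * v) * flat 1 (s * w) - 2 * s ^+ 2 * E1 (s * v) * E1 (s * w)
   + s ^+ 2 * flat 1 (s * v) * E2 (s * w)) * kA n v
  + 2 * (s * E1 (s * v) * flat 1 (s * w) - s * flat 1 (s * v) * E1 (s * w)) * kA1 n v
  + flat 1 (s * v) * flat 1 (s * w) * kA2 n v.

Lemma is_derive_sub (f : R -> R) (a s x l : R) : is_derive (s * (x - a)) 1 f l ->
  is_derive x 1 (fun u => f (s * (u - a))) (s * l).
Proof.
move=> fl; rewrite (_ : (fun u => _) = (fun u => f (s * u + - s * a))); last first.
  by apply/funext => u; congr f; ring.
by apply: is_derive_affine; rewrite (_ : s * x + - s * a = s * (x - a))//; ring.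
Qed.

Lemma is_derive_subN (f : R -> R) (b s x l : R) : is_derive (s * (b - x)) 1 f l ->
  is_derive x 1 (fun u => f (s * (b - u))) (- s * l).
Proof.
move=> fl; rewrite (_ : (fun u => _) = (fun u => f (- s * u + s * b))); last first.
  by apply/funext => u; congr f; ring.
by apply: is_derive_affine; rewrite (_ : - s * x + s * b = s * (b - x))//; ring.
Qed.

Lemma is_derive_sub1 (f : R -> R) (a x l : R) : is_derive (x - a) 1 f l ->
  is_derive x 1 (fun u => f (u - a)) l.
Proof.
move=> fl; rewrite (_ : (fun u => _) = (fun u => f (1 * (u - a)))); last first.
  by apply/funext => u; rewrite mul1r.
by rewrite -[l]mul1r; apply: is_derive_sub; rewrite mul1r.
Qed.

Lemma thA_derive2 n a s : ((thA n a s)^`()^`())%classic = thA2 n a s.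
Proof.
have dE x := is_derive_sub (is_derive_E (s * (x - a))).
have dE1 x := is_derive_sub (is_derive_E1 (s * (x - a))).
have dF x := is_derive_subN (is_derive_E (s * (a + 1 - x))).
have dF1 x := is_derive_subN (is_derive_E1 (s * (a + 1 - x))).
have dk x := is_derive_sub1 (is_derive_kA n (x - a)).
have dk1 x := is_derive_sub1 (is_derive_kA1 n (x - a)).
have cst_ (x c : R) := is_derive_cst c x 1.
have d1 x := is_derive_mul (is_derive_mul (dE x) (dF x)) (dk x).
rewrite (derive1_eq d1); apply: derive1_eq => x.
have := is_derive_add
  (is_derive_mul (is_derive_add
    (is_derive_mul (is_derive_mul (cst_ x s) (dE1 x)) (dF x))
    (is_derive_mul (dE x) (is_derive_mul (cst_ x (- s)) (dF1 x)))) (dk x))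
  (is_derive_mul (is_derive_mul (dE x) (dF x)) (dk1 x)).
by move=> H; apply: (is_derive_eq H); rewrite /thA2 /cst; ring.
Qed.

Lemma thA2_eq0 n a s u : 0 <= s -> ~ (a < u < a + 1) -> thA2 n a s u = 0.
Proof.
move=> s0 /negP; rewrite negb_and -!leNgt => /orP[ua|bu]; rewrite /thA2 /E1 /E2.
  have h : s * (u - a) <= 0 by rewrite mulr_ge0_le0// subr_le0.
  by rewrite !(flat0 _ h); ring.
have h : s * (a + 1 - u) <= 0 by rewrite mulr_ge0_le0// subr_le0.
by rewrite !(flat0 _ h); ring.
Qed.

(** Every [s] produced by differentiating a cut-off is combined with a distance [v] or [w] into a
    bounded [flat] function. The distances reappear as divisors of [kA] and [kA1], whose zeros
    compensate them, and no free power of [s] is left. *)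
Lemma thA2E n a s u : a < u < a + 1 ->
  let v := u - a in let w := a + 1 - u in
  thA2 n a s u =
  flat P2 (s * v) * flat 1 (s * w) * (kA n v / v ^+ 2)
  - 2 * flat 'X (s * v) * flat 'X (s * w) * (kA n v / (v * w))
  + flat 1 (s * v) * flat P2 (s * w) * (kA n v / w ^+ 2)
  + 2 * (flat 'X (s * v) * flat 1 (s * w) * (kA1 n v / v)
         - flat 1 (s * v) * flat 'X (s * w) * (kA1 n v / w))
  + flat 1 (s * v) * flat 1 (s * w) * kA2 n v.
Proof.
move=> /andP[ua ub] v w; rewrite /thA2 -/v -/w -!E1E -!E2E.
have v0 : v != 0 by rewrite gt_eqF// subr_gt0.
have w0 : w != 0 by rewrite gt_eqF// subr_gt0.
by field; rewrite v0 w0.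
Qed.

Lemma thA2_bounded n a : exists C : R, 0 <= C /\
  forall s u, 0 <= s -> `|thA2 n a s u| <= C.
Proof.
have [C1 [C10 HC1]] := @flat_bounded R 'X.
have [C2 [C20 HC2]] := @flat_bounded R P2.
have K0 := kK_ge0 n; pose K := kK n.
exists (C2 * 1 * K + 2 * C1 * C1 * K + 1 * C2 * K + 2 * (C1 * 1 * K + 1 * C1 * K) + 1 * 1 * K).
set B := (B in 0 <= B); have B0 : 0 <= B.
  by rewrite /B /K !mul1r !mulr1 !(addr_ge0, mulr_ge0).
split=> // s u s0.
have [uab|uab] := boolP (a < u < a + 1); last first.
  by rewrite thA2_eq0 ?normr0//; apply/negP.
rewrite thA2E//; set v := u - a; set w := a + 1 - u.
have /andP[ua ub] := uab.
have v0 : 0 < v by rewrite subr_gt0.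
have w0 : 0 < w by rewrite subr_gt0.
have wE : w = 1 - v by rewrite /w /v; ring.
have f1 y : `|flat 1 y| <= 1 :> R by rewrite ger0_norm ?flat1_ge0 ?flat1_le1.
have k1 : `|kA n v / v ^+ 2| <= K.
  rewrite normf_div (ger0_norm (sqr_ge0 v)) ler_pdivrMr ?exprn_gt0//; exact: kA_bound.
have k2 : `|kA n v / w ^+ 2| <= K.
  rewrite normf_div (ger0_norm (sqr_ge0 w)) ler_pdivrMr ?exprn_gt0// wE; exact: kA_bound'.
have k3 : `|kA n v / (v * w)| <= K.
  rewrite normf_div [`|v * w|]gtr0_norm ?mulr_gt0// ler_pdivrMr ?mulr_gt0//.
  (* For the mixed quotient the double zero at the nearer end point is used: the square of the
     smaller distance is at most [v * w]. *)
  have [vw|wv] := leP v w.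
    apply: (le_trans (kA_bound n v)); rewrite expr2 ler_wpM2l// ler_wpM2l//; exact: ltW.
  apply: (le_trans (kA_bound' n v)); rewrite -wE expr2 ler_wpM2l// ler_wpM2r//; exact: ltW.
have k4 : `|kA1 n v / v| <= K.
  rewrite normf_div (gtr0_norm v0) ler_pdivrMr// -[X in _ * X](gtr0_norm v0); exact: kA1_bound.
have k5 : `|kA1 n v / w| <= K.
  rewrite normf_div (gtr0_norm w0) ler_pdivrMr// -[X in _ * X](gtr0_norm w0) wE; exact: kA1_bound'.
have k6 := kA2_bound n v.
have M3 (x y z X Y Z : R) : `|x| <= X -> `|y| <= Y -> `|z| <= Z -> `|x * y * z| <= X * Y * Z.
  by move=> *; rewrite !normrM !ler_pM// mulr_ge0.
apply: (le_trans (ler_normD _ _)); apply: lerD; last exact: M3.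
apply: (le_trans (ler_normD _ _)); apply: lerD; last first.
  rewrite normrM ger0_norm// ler_wpM2l//.
  by apply: (le_trans (ler_normB _ _)); apply: lerD; exact: M3.
apply: (le_trans (ler_normD _ _)); apply: lerD; last exact: M3.
apply: (le_trans (ler_normB _ _)); apply: lerD; first exact: M3.
by apply: M3 => //; rewrite normrM ger0_norm// ler_wpM2l.
Qed.

Lemma cvgn_eq (f g : nat -> R) (l m : R) : f =1 g -> l = m ->
  g i @[i --> \oo] --> l -> f i @[i --> \oo] --> m.
Proof. by move=> /funext -> ->. Qed.

(** A differentiated cut-off contributes a factor [flat 'X] or [flat P2], both with a factor ['X] in
    the polynomial and so tending to [0]; only the term with [kA2] survives. *)
Lemma thA2_cvg n a u : a < u < a + 1 ->
  thA2 n a i.+1%:R u @[i --> \oo] --> kA2 n (u - a).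
Proof.
move=> uab; have /andP[ua ub] := uab.
have v0 : 0 < u - a by rewrite subr_gt0.
have w0 : 0 < a + 1 - u by rewrite subr_gt0.
set v := u - a; set w := a + 1 - u.
have fv := flat1_cvg v0; have fw := flat1_cvg w0.
have Xc (z : R) : 0 < z -> flat 'X (i.+1%:R * z) @[i --> \oo] --> (0 : R).
  by move=> z0; have := flatXM_cvg 1 z0; rewrite mulr1.
have xv := Xc _ v0; have xw := Xc _ w0.
have pv := flatXM_cvg ('X - 2%:P) v0; have pw := flatXM_cvg ('X - 2%:P) w0.
apply: (cvgn_eq (l := 0 * 1 * (kA n v / v ^+ 2)
  - 2 * 0 * 0 * (kA n v / (v * w)) + 1 * 0 * (kA n v / w ^+ 2)
  + 2 * (0 * 1 * (kA1 n v / v) - 1 * 0 * (kA1 n v / w)) + 1 * 1 * kA2 n v)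
  (fun i => thA2E n _ uab)); first by ring.
have cM (f g : nat -> R) (l m c : R) : f i @[i --> \oo] --> l -> g i @[i --> \oo] --> m ->
    f i * g i * c @[i --> \oo] --> l * m * c.
  by move=> fl gm; apply: cvgMl; exact: cvgM.
apply: cvgD; last exact: cM.
apply: cvgD; last first.
  by apply: cvgMr; apply: cvgB; exact: cM.
apply: cvgD; last exact: cM.
apply: cvgB; first exact: cM.
by apply: cM => //; apply: cvgMr.
Qed.

Lemma thQ_cvg n a u : a < u < a + 1 ->
  thQ n a i.+1%:R u @[i --> \oo] --> kQ n (u - a).
Proof.
move=> /andP[ua ub].
apply: (cvgn_eq (l := 1 * 1 * kQ n (u - a)) (fun=> erefl)); first by rewrite !mul1r.
by apply: cvgMl; apply: cvgM; apply: flat1_cvg; rewrite subr_gt0.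
Qed.

Lemma cutoff_norm_le a b s u (x M : R) : `|x| <= M -> `|cutoff a b s u * x| <= M.
Proof.
move=> xM; rewrite normrM ger0_norm ?cutoff_ge0// (le_trans _ xM)// ler_piMl//.
exact: cutoff_le1.
Qed.

Lemma thA_le4 n a s u : `|thA n a s u| <= 4.
Proof. by apply: cutoff_norm_le; exact: kA_le4. Qed.

Lemma thQ_le4 n a s u : `|thQ n a s u| <= 4.
Proof. by apply: cutoff_norm_le; exact: kQ_le4. Qed.

Lemma thA_eq0 n a s u : 0 <= s -> ~ (a < u < a + 1) -> thA n a s u = 0.
Proof. by move=> s0 uab; rewrite /thA cutoff_eq0 ?mul0r. Qed.

Lemma thQ_eq0 n a s u : 0 <= s -> ~ (a < u < a + 1) -> thQ n a s u = 0.
Proof. by move=> s0 uab; rewrite /thQ cutoff_eq0 ?mul0r. Qed.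

Let smc_cosl (c a : R) : smc (fun u => cos (c * (u - a))).
Proof.
rewrite (_ : (fun u => _) = (fun u => cos (c * u + - c * a))); first exact: smc_cos.
by apply/funext => u; congr cos; ring.
Qed.

Lemma smc_thA n a s : smc (thA n a s).
Proof.
apply: smc_mul; first exact: smc_cutoff.
rewrite (_ : (fun u => _) = fun u => kap n / pi ^+ 2 * (cos (pi * par n * (u - a)) +
  (-1) * cos (pi * n%:R * (u - a)))); last by apply/funext => u; rewrite mulN1r.
apply: smc_mul; first exact: smc_cst.
apply: smc_add; first exact: smc_cosl.
by apply: smc_mul; [exact: smc_cst|exact: smc_cosl].
Qed.

Lemma smc_thQ n a s : smc (thQ n a s).
Proof.
apply: smc_mul; first exact: smc_cutoff.
apply: smc_add; last exact: smc_cst.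
by apply: smc_mul; [exact: smc_cst|exact: smc_cosl].
Qed.

End Kernel.

(** * Fourier coefficients of the tent transform *)

Section TentFourier.
Context {R : realType} {d : nat}.
Local Notation X := (rVb R d).
Local Notation leb := (@lebesgue_measure R).
Implicit Types (f g H : 'rV[R]_d -> R) (y : 'rV[R]_d) (m k : 'rV[int]_d).

Definition DC : nat -> set R := fun=> `[0, 1]%classic.
Lemma mDC j : measurable (DC j). Proof. exact: measurable_itv. Qed.
Local Notation muC := (gmeas mDC : set X -> \bar R).

Definition reflc (i : 'I_d) : nat -> R -> R := fun j t => if j == i then 1 - t else t.

Lemma measurable_reflc i j : measurable_fun setT (reflc i j).
Proof. by rewrite /reflc; case: (j == i) => //; exact: measurable_funB. Qed.

Lemma reflc_push i j (h : R -> \bar R) : measurable_fun setT h -> (forall t, 0 <= h t)%E ->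
  (\int[leb]_(t in DC j) h (reflc i j t) = \int[leb]_(t in DC j) h t)%E.
Proof. by move=> mh h0; rewrite /reflc /DC; case: (j == i) => //; exact: ge0_integral_reflect. Qed.

Lemma integral_reflc i (F : 'rV[R]_d -> \bar R) : measurable_fun setT (F : X -> \bar R) ->
  (\int[muC]_y F (mapc (reflc i) y) = \int[muC]_y F y)%E.
Proof.
by move=> mF; exact: (@integral_mapc _ _ _ _ mDC mDC _ (measurable_reflc i) (reflc_push i) F mF).
Qed.

Lemma integrable_bounded_mul (mu : {measure set X -> \bar R}) H (b : 'rV[R]_d -> R) (M : R) :
  measurable_fun setT (b : X -> R) -> (forall y, `|b y| <= M) ->
  mu.-integrable setT (fun y : X => (H y)%:E) ->
  mu.-integrable setT (fun y : X => (H y * b y)%:E).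
Proof.
move=> mb bM iH; have mH : measurable_fun setT (H : X -> R).
  by apply/measurable_EFinP; exact: measurable_int iH.
apply: (@le_integrable _ X R mu setT measurableT _ (fun y : X => (M%:E * (H y)%:E)%E)).
- by apply/measurable_EFinP; exact: measurable_funM.
- move=> y _; rewrite -EFinM !abse_EFin lee_fin !normrM mulrC ler_wpM2r//.
  by apply: le_trans (bM y) _; exact: ler_norm.
- exact: integrableZl.
Qed.

(** The measure on the cube is invariant under the reflection, so [A] and its reflection have equal
    integrals. *)
Lemma integral_avg i (A C : 'rV[R]_d -> R) :
  muC.-integrable setT (fun y : X => (A y)%:E) ->
  muC.-integrable setT (fun y : X => (C y)%:E) ->
  (forall y, A y + A (mapc (reflc i) y) = 2 * C y) ->
  (\int[muC]_y (A y)%:E = \int[muC]_y (C y)%:E)%E.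
Proof.
move=> iA iC AC.
have mA : measurable_fun setT (fun y : X => (A y)%:E) by exact: measurable_int iA.
have iA' : muC.-integrable setT (fun y : X => (A (mapc (reflc i) y))%:E).
  apply/integrableP; split.
    exact: (measurableT_comp mA (measurable_mapc (measurable_reflc i))).
  have /integrableP[_] := iA; rewrite -(integral_reflc i)//.
  exact: measurableT_comp.
have e1 := integral_reflc i mA.
have : (\int[muC]_y (A y)%:E + \int[muC]_y (A (mapc (reflc i) y))%:E =
        2%:E * \int[muC]_y (C y)%:E)%E.
  rewrite -integralD// -integralZl//; apply: eq_integral => y _.
  by rewrite -EFinD -EFinM AC.
rewrite e1 -(fineK (integrable_fin_num measurableT iA)).
rewrite -(fineK (integrable_fin_num measurableT iC)) -EFinD -EFinM => -[e2].
by congr EFin; lra.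
Qed.

Lemma cosD2pi_int (x : R) (c : int) : cos (2 * pi * c%:~R + x) = cos x.
Proof.
case: c => n.
  rewrite addrC (_ : 2 * pi * n%:~R = (2 * n)%:R * pi); last by rewrite natrM; ring.
  by rewrite cosDnpi exprM sqrrN !expr1n mul1r.
rewrite NegzE -[in RHS](subrK ((2 * n.+1)%:R * pi) x) cosDnpi exprM sqrrN !expr1n mul1r.
by congr cos; rewrite natrM mulrNz -pmulrn; ring.
Qed.

Lemma sinD2pi_int (x : R) (c : int) : sin (2 * pi * c%:~R + x) = sin x.
Proof.
by have := cosD2pi_int (x - pi / 2) c; rewrite addrA !cosBpihalf.
Qed.

Definition alf k (i : 'I_d) y : R := 2 * pi * (k ord0 i)%:~R * y ord0 i.

Lemma measurable_alf k i : measurable_fun setT (alf k i : X -> R).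
Proof. by apply: measurable_funM => //; exact: measurable_coord. Qed.

Lemma mapc_reflc i y j : mapc (reflc i) y ord0 j = if j == i then 1 - y ord0 j else y ord0 j.
Proof. by rewrite mxE. Qed.

Lemma measurable_cos_comp (h : 'rV[R]_d -> R) : measurable_fun setT (h : X -> R) ->
  measurable_fun setT (fun y : X => cos (h y)).
Proof.
move=> mh; apply: (measurableT_comp _ mh); apply: continuous_measurable_fun.
exact: continuous_cos.
Qed.

Lemma measurable_sin_comp (h : 'rV[R]_d -> R) : measurable_fun setT (h : X -> R) ->
  measurable_fun setT (fun y : X => sin (h y)).
Proof.
move=> mh; apply: (measurableT_comp _ mh); apply: continuous_measurable_fun.
exact: continuous_sin.
Qed.

(* Averaging over [y_i |-> 1 - y_i] turns [cos (a_i + S)] into [cos a_i * cos S]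
   and [sin (a_i + S)] into [cos a_i * sin S]. *)
Lemma integral_symmetric_phase k (s : seq 'I_d) H : uniq s ->
  muC.-integrable setT (fun y : X => (H y)%:E) ->
  (forall i y, H (mapc (reflc i) y) = H y) ->
  (\int[muC]_y (H y * cos (\sum_(i <- s) alf k i y))%:E =
   \int[muC]_y (H y * \prod_(i <- s) cos (alf k i y))%:E /\
   \int[muC]_y (H y * sin (\sum_(i <- s) alf k i y))%:E = 0)%E.
Proof.
elim: s H => [|i s IH] H /=.
  move=> _ _ _; split; first by apply: eq_integral => y _; rewrite !big_nil cos0.
  by rewrite -[RHS](integral0 muC setT); apply: eq_integral => y _; rewrite big_nil sin0 mulr0.
move=> /andP[is_ us] iH symH.
pose S y := \sum_(j <- s) alf k j y.
have mS : measurable_fun setT (S : X -> R).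
  by apply: measurable_sum => j; exact: measurable_alf.
have symS y : S (mapc (reflc i) y) = S y.
  rewrite /S big_seq [RHS]big_seq; apply: eq_bigr => j js; rewrite /alf mapc_reflc ifN//.
  by apply: contraNneq is_ => <-.
pose H' y := H y * cos (alf k i y).
have mai := measurable_alf k i.
have iH' : muC.-integrable setT (fun y : X => (H' y)%:E).
  apply: (@integrable_bounded_mul _ _ _ 1) => //; first exact: measurable_cos_comp.
  by move=> y; exact: cos_max.
have alf_refl y : alf k i (mapc (reflc i) y) = 2 * pi * (k ord0 i)%:~R + - alf k i y.
  by rewrite /alf mapc_reflc eqxx; ring.
have symH' j y : H' (mapc (reflc j) y) = H' y.
  rewrite /H' symH; congr (_ * _); have [<-|ij] := eqVneq i j.
    by rewrite alf_refl cosD2pi_int cosN.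
  by rewrite /alf mapc_reflc (negPf ij).
have [IHc IHs] := IH H' us iH' symH'; split.
- rewrite (@integral_avg i _ (fun y => H' y * cos (S y))).
  + by rewrite IHc; apply: eq_integral => y _; rewrite big_cons /H' mulrA.
  + apply: (@integrable_bounded_mul _ _ _ 1) => //; last by move=> y; exact: cos_max.
    apply: measurable_cos_comp; apply: measurable_sum => j; exact: measurable_alf.
  + apply: (@integrable_bounded_mul _ _ _ 1) => //; last by move=> y; exact: cos_max.
    exact: measurable_cos_comp.
  + move=> y; rewrite !big_cons -/(S y) -/(S _) symH symS alf_refl /H' -addrA cosD2pi_int.
    by rewrite !cosD cosN sinN; ring.
- rewrite (@integral_avg i _ (fun y => H' y * sin (S y)))//.
  + apply: (@integrable_bounded_mul _ _ _ 1) => //; last by move=> y; exact: sin_max.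
    apply: measurable_sin_comp; apply: measurable_sum => j; exact: measurable_alf.
  + apply: (@integrable_bounded_mul _ _ _ 1) => //; last by move=> y; exact: sin_max.
    exact: measurable_sin_comp.
  + move=> y; rewrite !big_cons -/(S y) -/(S _) symH symS alf_refl /H' -addrA sinD2pi_int.
    by rewrite !sinD cosN sinN; ring.
Qed.

(* The components of [m], extended by [0] beyond [d]. *)
Definition mnat m (j : nat) : R := if insub j is Some i then (m ord0 (i : 'I_d))%:~R else 0.

Lemma mnatE m (i : 'I_d) : mnat m i = (m ord0 i)%:~R.
Proof. by rewrite /mnat valK. Qed.

Definition QD m : nat -> set R := fun j => `](- mnat m j), (1 - mnat m j)[%classic.
Lemma mQD m j : measurable (QD m j). Proof. exact: measurable_itv. Qed.
Local Notation muQ m := (gmeas (mQD m) : set X -> \bar R).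

Lemma muQ_setT m : (muQ m setT = 1)%E.
Proof.
apply: gmeas_probability => j; rewrite /QD lebesgue_measure_itv/= lte_fin ifT; last by lra.
by rewrite -EFinB; congr EFin; lra.
Qed.

Definition tentc m : nat -> R -> R := fun j t => `|2 * t - 1| - mnat m j.

Lemma measurable_tentc m j : measurable_fun setT (tentc m j).
Proof.
apply: measurable_funB => //; apply: measurableT_comp => //.
exact: (measurable_affine 2 (-1)).
Qed.

Lemma tentc_push m j (h : R -> \bar R) : measurable_fun setT h -> (forall t, 0 <= h t)%E ->
  (\int[leb]_(t in DC j) h (tentc m j t) = \int[leb]_(t in QD m j) h t)%E.
Proof. by move=> mh h0; exact: ge0_integral_tent. Qed.

Lemma tent_shiftE f m y : tent_shift f m y = f (mapc (tentc m) y).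
Proof. by congr f; apply/rowP => j; rewrite !mxE /tentc mnatE. Qed.

Lemma integral_tentc m (F : 'rV[R]_d -> \bar R) : measurable_fun setT (F : X -> \bar R) ->
  (\int[muC]_y F (mapc (tentc m) y) = \int[muQ m]_y F y)%E.
Proof.
move=> mF.
exact: (@integral_mapc _ _ _ _ mDC (mQD m) _ (measurable_tentc m) (tentc_push m) F mF).
Qed.

(** [y + m] is the value [|2 t - 1|] of the tent map, so this is the Fourier kernel in the new
    variable, up to [ksign]. *)
Definition Kc k m y : R := \prod_i cos (pi * `|k ord0 i|%N%:R * (y ord0 i + (m ord0 i)%:~R)).

Lemma Kc_le1 k m y : `|Kc k m y| <= 1.
Proof. by rewrite normr_prod; apply: prodr_ile1 => i _; rewrite normr_ge0 cos_max. Qed.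

Lemma measurable_Kc k m : measurable_fun setT (Kc k m : X -> R).
Proof.
apply: (@measurable_tensor R d (fun i t =>
  cos (pi * `|k ord0 i|%N%:R * (t + (m ord0 i)%:~R)))) => i t.
apply: (@continuous_comp _ _ _ (fun t : R => pi * `|k ord0 i|%N%:R * (t + (m ord0 i)%:~R)) cos).
  by apply: cvgMr; apply: cvgD; [exact: cvg_id|exact: cvg_cst].
exact: continuous_cos.
Qed.

(** Since [|2 t - 1|] enters an even function, each coordinate turns into the cosine of
    [2 pi n t - n pi], which accounts for a sign [(-1) ^+ n]. It disappears on squaring. *)
Definition ksign k : R := \prod_(i < d) (-1) ^+ `|k ord0 i|%N.

Lemma ksign_sqr k : ksign k ^+ 2 = 1.
Proof. by rewrite /ksign -prodrXl big1// => i _; rewrite -exprM mulnC exprM sqrrN !expr1n. Qed.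

Lemma cos_abs (x : R) : cos `|x| = cos x.
Proof. by have [x0|x0] := leP 0 x; [rewrite ger0_norm|rewrite ltr0_norm// cosN]. Qed.

Lemma prod_cos_alf k m y :
  \prod_i cos (alf k i y) = ksign k * Kc k m (mapc (tentc m) y).
Proof.
rewrite /ksign /Kc -big_split/=; apply: eq_bigr => i _.
rewrite mxE /tentc mnatE subrK; set n := `|k ord0 i|%N.
rewrite -(ger0_norm (mulr_ge0 (pi_ge0 R) (ler0n R n))) -normrM cos_abs -cosDnpi.
have -> : alf k i y = 2 * pi * (k ord0 i)%:~R * y ord0 i by [].
have [kn|kn] : (k ord0 i)%:~R = n%:R :> R \/ (k ord0 i)%:~R = - n%:R :> R.
  by rewrite /n; case: (k ord0 i) => j; [left|right; rewrite NegzE mulrNz].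
  by rewrite kn; congr cos; ring.
by rewrite kn -cosN; congr cos; ring.
Qed.

Lemma kdot_alf k y : 2 * pi * kdot k y = \sum_(i <- index_enum 'I_d) alf k i y.
Proof. by rewrite /kdot mulr_sumr; apply: eq_bigr => i _; rewrite /alf mulrA. Qed.

Lemma measurable_kdot k : measurable_fun setT (fun y : X => 2 * pi * kdot k y).
Proof.
rewrite (_ : (fun _ => _) = (fun y : X => \sum_(i <- index_enum 'I_d) alf k i y)).
  by apply: measurable_sum => j; exact: measurable_alf.
by apply/funext => y; rewrite kdot_alf.
Qed.

(** Composition with the tent map is fixed by the reflections, so the sine integral vanishes and the
    coefficient is real. Replacing [f] by [g] is allowed because the tent map pulls null sets back
    to null sets. *)
Lemma fourier_abs2_tent f g k m :
  measurable_fun setT (f : X -> R) -> measurable_fun setT (g : X -> R) ->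
  gmeas mDTP [set y : X | f y != g y] = 0%E ->
  (muQ m).-integrable setT (fun y : X => (g y)%:E) ->
  (fourier_abs2 (tent_shift f m) k = (\int[muQ m]_y (g y * Kc k m y)%:E) ^+ 2)%E.
Proof.
move=> mf mg fg0 ig.
have mT := measurable_mapc (measurable_tentc m) : measurable_fun setT (mapc (tentc m) : X -> X).
pose E := [set y : X | f y != g y].
have mE : measurable E := measurable_neq_rV mf mg.
pose E' : set X := mapc (tentc m) @^-1` E.
have mE' : measurable E' by rewrite -[E']setTI; exact: mT.
(* The measure of the preimage is that of [E] on the cube, which is at most the measure of [E] in
   the whole space. *)
have E'0 : giint DC d (fun y => (\1_E' y)%:E) 0 = 0%E.
  rewrite -(ge0_integral_gmeas mDC (measurable_indic_EFin mE'))//.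
  have := integral_tentc m (measurable_indic_EFin mE).
  rewrite (_ : (fun y => (\1_E (mapc (tentc m) y))%:E) = (fun y => (\1_E' y)%:E))// => ->.
  rewrite (ge0_integral_gmeas (mQD m) (measurable_indic_EFin mE))//.
  apply/eqP; rewrite eq_le; apply/andP; split; last by apply: giint_ge0 => y; rewrite lee_fin.
  rewrite -fg0 -[leLHS]/(gmeas (mQD m) E) gmeas_restr.
  apply: le_measure; rewrite ?inE//.
  by apply: measurableI => //; exact: (measurable_box (mQD m)).
have iC : muC.-integrable setT (fun y : X => (g (mapc (tentc m) y))%:E).
  apply/integrableP; split; first by apply/measurable_EFinP; exact: (measurableT_comp mg mT).
  have /integrableP[mg' gfin] := ig.
  rewrite (integral_tentc m (F := fun y => `|(g y)%:E|%E))//.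
  exact: (measurableT_comp _ mg').
have swap (b : 'rV[R]_d -> R) : measurable_fun setT (b : X -> R) -> (forall y, `|b y| <= 1) ->
    integral_d `[0, 1] (fun y => (tent_shift f m y * b y)%:E) =
    (\int[muC]_y (g (mapc (tentc m) y) * b y)%:E)%E.
  move=> mb b1.
  rewrite (integral_gmeas (mD := mDC)); last exact: (integrable_bounded_mul mb b1 iC).
  rewrite /integral_d iint_giint; apply: (@giint_ae_eq _ _ DC mDC _ E') => //.
  - apply/measurable_EFinP; apply: measurable_funM => //.
    rewrite (_ : tent_shift f m = f \o mapc (tentc m)); first exact: (measurableT_comp mf mT).
    by apply/funext => y; rewrite tent_shiftE.
  - by apply/measurable_EFinP; apply: measurable_funM => //; exact: (measurableT_comp mg mT).
  - move=> y; rewrite /E' /E/= => /negP; rewrite negbK => /eqP fgy.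
    by rewrite tent_shiftE fgy.
have symg i y : g (mapc (tentc m) (mapc (reflc i) y)) = g (mapc (tentc m) y).
  congr g; apply/rowP => j; rewrite !mxE /reflc /tentc.
  case: ifP => // _; congr (_ - _).
  by rewrite (_ : 2 * (1 - y ord0 j) - 1 = - (2 * y ord0 j - 1)) ?normrN//; ring.
have [Hc Hs] := integral_symmetric_phase k (index_enum_uniq _) iC symg.
have re : fourier_re (tent_shift f m) k =
    ((ksign k)%:E * \int[muQ m]_y (g y * Kc k m y)%:E)%E.
  rewrite /fourier_re swap; last by move=> y; exact: cos_max.
    under eq_integral do rewrite kdot_alf.
    rewrite Hc -integralZl//; last first.
      by apply: (integrable_bounded_mul (measurable_Kc k m)) => // y; exact: Kc_le1.
    rewrite -(integral_tentc m); last first.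
      apply: measurable_funeM; apply/measurable_EFinP; apply: measurable_funM => //.
      exact: measurable_Kc.
    by apply: eq_integral => y _; rewrite (prod_cos_alf k m) -EFinM mulrCA.
  by apply: measurable_cos_comp; exact: measurable_kdot.
have im : fourier_im (tent_shift f m) k = 0%E.
  rewrite /fourier_im (_ : (fun x => _) = (fun y : 'rV[R]_d =>
    (tent_shift f m y * - sin (2 * pi * kdot k y))%:E)); last first.
    by apply/funext => y; rewrite mulrN.
  rewrite (swap (fun y => - sin (2 * pi * kdot k y))).
  - under eq_integral do rewrite kdot_alf mulrN EFinN.
    rewrite integralN/=; first by rewrite Hs oppe0.
    apply: integrable_add_def => //.
    apply: (@integrable_bounded_mul _ _ _ 1) => //; last by move=> y; exact: sin_max.
    by apply: measurable_sin_comp; apply: measurable_sum => j; exact: measurable_alf.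
  - by apply: measurableT_comp => //; apply: measurable_sin_comp; exact: measurable_kdot.
  - by move=> y; rewrite normrN sin_max.
by rewrite /fourier_abs2 re im !expe2 mul0e adde0 muleACA -EFinM -expr2 ksign_sqr mul1e.
Qed.

End TentFourier.

(** * The estimate on one cube, and summation over the cubes *)

Section Cubes.
Context {R : realType} {d : nat}.
Local Notation X := (rVb R d).
Local Notation mu := (gmeas (@mDTP R) : set X -> \bar R).
Local Notation muQ m := (gmeas (@mQD R d m) : set X -> \bar R).
Local Notation Q m := (box (@QD R d m) d : set X).
Implicit Types (f g h : 'rV[R]_d -> R) (y : 'rV[R]_d) (m k : 'rV[int]_d) (e : {set 'I_d}).
Local Open Scope ereal_scope.

Lemma measurable_sqr_EFin h : measurable_fun setT (h : X -> R) ->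
  measurable_fun setT (fun y : X => (h y ^+ 2)%:E).
Proof. by move=> mh; apply/measurable_EFinP; exact: measurable_funX. Qed.

Lemma L2sqE h : measurable_fun setT (h : X -> R) -> L2sq h = \int[mu]_y (h y ^+ 2)%:E.
Proof.
move=> mh; rewrite /L2sq /integral_d iint_giint ge0_integral_gmeas//.
  exact: measurable_sqr_EFin.
by move=> y; rewrite lee_fin sqr_ge0.
Qed.

Lemma ge0_integral_muQ m (F : 'rV[R]_d -> \bar R) : measurable_fun setT (F : X -> \bar R) ->
  (forall y, 0 <= F y) -> \int[muQ m]_y F y = \int[mu]_(y in Q m) F y.
Proof. by move=> mF F0; exact: (ge0_integral_gmeas_restr (mQD m) mF F0). Qed.

Lemma integral_muQ m (F : 'rV[R]_d -> \bar R) : measurable_fun setT (F : X -> \bar R) ->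
  \int[muQ m]_y F y = \int[mu]_(y in Q m) F y.
Proof. by move=> mF; exact: (integral_gmeas_restr (mQD m) mF). Qed.

Lemma measurable_Q m : measurable (Q m).
Proof. exact: (measurable_box (mQD m)). Qed.

Lemma Q_mem m y : Q m y <-> forall i : 'I_d, (- (m ord0 i)%:~R < y ord0 i < - (m ord0 i)%:~R + 1)%R.
Proof.
split=> [Qy i|Qy i _]; last by rewrite /QD/= in_itv/= mnatE addrC; exact: Qy.
by have := Qy i (ltn_ord i); rewrite /QD/= in_itv/= mnatE addrC.
Qed.

Lemma integral_muQ_sqr_le m h : measurable_fun setT (h : X -> R) ->
  \int[muQ m]_y (h y ^+ 2)%:E <= L2sq h.
Proof.
move=> mh; have m2 := measurable_sqr_EFin mh; rewrite L2sqE// ge0_integral_muQ//.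
  by apply: ge0_subset_integral => //; [exact: measurable_Q|move=> y _; rewrite lee_fin sqr_ge0].
by move=> y; rewrite lee_fin sqr_ge0.
Qed.

Lemma integral_muQ_cst m (c : R) : \int[muQ m]_y c%:E = c%:E.
Proof.
rewrite (integral_cst (gmeas (mQD m)) measurableT).
exact: (etrans (congr1 (mule c%:E) (muQ_setT m)) (mule1 _)).
Qed.

(** The cube has measure one and [|h| <= 1 + h ^+ 2]. *)
Lemma integrable_muQ m h : measurable_fun setT (h : X -> R) -> L2sq h < +oo ->
  (muQ m).-integrable setT (fun y : X => (h y)%:E).
Proof.
move=> mh h2; apply/integrableP; split; first exact/measurable_EFinP.
have m2 := measurable_sqr_EFin mh.
apply: (@le_lt_trans _ _ (\int[muQ m]_y (1 + (h y ^+ 2)%:E))).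
  apply: ge0_le_integral => //.
  - by apply: measurableT_comp => //; exact/measurable_EFinP.
  - exact: emeasurable_funD.
  - move=> y _; rewrite abse_EFin -EFinD lee_fin -(real_normK (num_real (h y))).
    by move: `|h y|%R (normr_ge0 (h y)) => t t0; nra.
rewrite ge0_integralD//; last by move=> y _; rewrite lee_fin sqr_ge0.
rewrite integral_muQ_cst lte_add_pinfty ?ltry//.
by apply: le_lt_trans h2; exact: integral_muQ_sqr_le.
Qed.

(** Cauchy-Schwarz in elementary form: with [I] the mean of [|h|], integrate
    [2 * I * |h| <= h ^+ 2 + I ^+ 2] over a cube of measure one. *)
Lemma norm_integral_muQ_le m h : measurable_fun setT (h : X -> R) -> L2sq h < +oo ->
  (fine (\int[muQ m]_y `|h y|%:E) ^+ 2 <= fine (\int[muQ m]_y (h y ^+ 2)%:E))%R.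
Proof.
move=> mh h2; have m2 := measurable_sqr_EFin mh.
have ih := integrable_muQ m mh h2.
have mh1 : measurable_fun setT (fun y : X => `|h y|%:E).
  by apply/measurable_EFinP; exact: measurableT_comp.
have fin1 : \int[muQ m]_y `|h y|%:E \is a fin_num.
  rewrite ge0_fin_numE; last by apply: integral_ge0 => y _; rewrite lee_fin.
  by have /integrableP[_] := ih.
have fin2 : \int[muQ m]_y (h y ^+ 2)%:E \is a fin_num.
  rewrite ge0_fin_numE; last by apply: integral_ge0 => y _; rewrite lee_fin sqr_ge0.
  by apply: le_lt_trans h2; exact: integral_muQ_sqr_le.
set I := fine (\int[muQ m]_y `|h y|%:E).
have I0 : (0 <= I)%R by apply: fine_ge0; apply: integral_ge0 => y _; rewrite lee_fin.
have : \int[muQ m]_y ((2 * I)%:E * `|h y|%:E) <= \int[muQ m]_y ((h y ^+ 2)%:E + (I ^+ 2)%:E).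
  apply: ge0_le_integral => //.
  - by move=> y _; rewrite -EFinM lee_fin !mulr_ge0.
  - exact: measurable_funeM.
  - exact: emeasurable_funD.
  - move=> y _; rewrite -EFinM -EFinD lee_fin -(real_normK (num_real (h y))).
    have := sqr_ge0 (`|h y| - I)%R; rewrite sqrrB; lra.
rewrite ge0_integralZl//; last by rewrite lee_fin mulr_ge0.
rewrite ge0_integralD//; try by move=> y _; rewrite lee_fin sqr_ge0.
rewrite integral_muQ_cst -(fineK fin1) -(fineK fin2) -/I -EFinM -EFinD lee_fin.
by rewrite /=; move: (fine (\int[muQ m]_y (h y ^+ 2)%:E)) => J; clearbody I; nra.
Qed.

Lemma trivIset_Q : trivIset setT (fun m => Q m).
Proof.
apply/trivIsetP => m m' _ _ mm'; rewrite -subset0 => y [/Q_mem Qy /Q_mem Qy'].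
move/eqP: mm'; apply; apply/rowP => i; have /andP[a1 a2] := Qy i; have /andP[b1 b2] := Qy' i.
have H1 : ((m ord0 i)%:~R < (m' ord0 i)%:~R + 1 :> R)%R by lra.
have H2 : ((m' ord0 i)%:~R < (m ord0 i)%:~R + 1 :> R)%R by lra.
by move: H1 H2; rewrite -!intrD1 !ltr_int !ltzD1 => H1 H2; apply/eqP; rewrite eq_le H1 H2.
Qed.

Lemma sum_muQ_sqr_le (s : seq 'rV[int]_d) h : uniq s ->
  measurable_fun setT (h : X -> R) -> L2sq h < +oo ->
  (\sum_(m <- s) fine (\int[muQ m]_y (h y ^+ 2)%:E) <= fine (L2sq h))%R.
Proof.
move=> us mh h2; have m2 := measurable_sqr_EFin mh.
have fin m : \int[muQ m]_y (h y ^+ 2)%:E \is a fin_num.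
  rewrite ge0_fin_numE; last by apply: integral_ge0 => y _; rewrite lee_fin sqr_ge0.
  by apply: le_lt_trans h2; exact: integral_muQ_sqr_le.
have finL : L2sq h \is a fin_num.
  by rewrite ge0_fin_numE// L2sqE//; apply: integral_ge0 => y _; rewrite lee_fin sqr_ge0.
rewrite -lee_fin fineK// -sumEFin (eq_bigr (fun m => \int[mu]_(y in Q m) (h y ^+ 2)%:E));
  last first.
  by move=> m _; rewrite fineK// ge0_integral_muQ// => y; rewrite lee_fin sqr_ge0.
rewrite -(ge0_integral_bigsetU mu)//.
- rewrite L2sqE//; apply: ge0_subset_integral => //.
  + by apply: bigsetU_measurable => m _; exact: measurable_Q.
  + by move=> y _; rewrite lee_fin sqr_ge0.
- by move=> m; exact: measurable_Q.
- exact: (sub_trivIset _ trivIset_Q).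
- exact: measurable_funTS.
- by move=> y _; rewrite lee_fin sqr_ge0.
Qed.

(** Links the weak identities, which integrate over the whole space, with the cube: as [b] vanishes
    off [Q m], integrability on the cube gives integrability everywhere. *)
Lemma giint_muQ m h (b : 'rV[R]_d -> R) (M : R) : measurable_fun setT (h : X -> R) ->
  (muQ m).-integrable setT (fun y : X => (h y)%:E) ->
  measurable_fun setT (b : X -> R) -> (forall y, `|b y| <= M)%R ->
  (forall y, ~ Q m y -> b y = 0%R) ->
  giint (fun=> setT) d (fun y => (h y * b y)%:E) 0 = \int[muQ m]_y (h y * b y)%:E.
Proof.
move=> mh ih mb bM b0.
have mF : measurable_fun setT (fun y : X => (h y * b y)%:E).
  by apply/measurable_EFinP; exact: measurable_funM.
have mF1 : measurable_fun setT (fun y : X => `|(h y * b y)%:E|) by exact: measurableT_comp.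
have /integrableP[_ fi] := integrable_bounded_mul mb bM ih.
have iF : mu.-integrable setT (fun y : X => (h y * b y)%:E).
  apply/integrableP; split => //; apply: le_lt_trans fi.
  rewrite ge0_integral_muQ// [leRHS]integral_mkcond le_eqVlt; apply/orP; left; apply/eqP.
  apply: eq_integral => y _; rewrite patchE; case: ifPn => // /negP; rewrite inE => /b0 ->.
  by rewrite mulr0 abse0.
rewrite -(integral_gmeas iF) integral_muQ// [RHS]integral_mkcond.
apply: eq_integral => y _; rewrite patchE; case: ifPn => // /negP; rewrite inE => /b0 ->.
by rewrite mulr0.
Qed.

(** * Weak derivatives tested on the cubes *)

Section Estimate.
Variables (f : 'rV[R]_d -> R) (G : {set 'I_d} -> 'rV[R]_d -> R).
Hypothesis fG : H2mix_witness f G.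
Let g := G finset.set0.

Let mf : measurable_fun setT (f : X -> R). Proof. by apply/measurable_dP; case: fG. Qed.
Let mG e : measurable_fun setT (G e : X -> R).
Proof. by apply/measurable_dP; case: fG => _ /(_ e)[]. Qed.
Let G2 e : L2sq (G e) < +oo. Proof. by case: fG => _ /(_ e)[]. Qed.

Lemma witness_ae_eq : mu [set y : X | f y != g y] = 0.
Proof.
by case: fG => mf' /(_ finset.set0)[mg' g2 w]; exact: weak_set0_ae_eq.
Qed.

Lemma norm_tensor_le (th : 'I_d -> R -> R) (M : 'I_d -> R) y :
  (forall j u, `|th j u| <= M j)%R -> (`|tensor th y| <= \prod_j M j)%R.
Proof.
by move=> thM; rewrite normr_prod; apply: ler_prod => j _; rewrite normr_ge0 thM.
Qed.

Lemma tensor_Q0 m (th : 'I_d -> R -> R) y :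
  (forall j u, ~ (- (m ord0 j)%:~R < u < - (m ord0 j)%:~R + 1)%R -> th j u = 0%R) ->
  ~ Q m y -> tensor th y = 0%R.
Proof.
move=> th0 nQ; apply: contrapT => t0; apply: nQ; apply/Q_mem => i.
apply: contrapT => /th0 thi; apply: t0.
by rewrite /tensor (bigD1 i)//= thi mul0r.
Qed.

(** The weak identity is tested with [tensor th], and [f] is then replaced by [g] off a null set.
    [th2] is a separate argument so that explicit formulas for the second derivatives can be
    supplied; [M] and [M2] provide integrability. *)
Lemma weak_transfer e m (th th2 : 'I_d -> R -> R) (M M2 : 'I_d -> R) :
  (forall j, smc (th j)) ->
  (forall j, th2 j = if j \in e then (th j)^`()^`()%classic else th j) ->
  (forall j u, `|th j u| <= M j)%R -> (forall j u, `|th2 j u| <= M2 j)%R ->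
  (forall j u, ~ (- (m ord0 j)%:~R < u < - (m ord0 j)%:~R + 1)%R -> th j u = 0%R) ->
  (forall j u, ~ (- (m ord0 j)%:~R < u < - (m ord0 j)%:~R + 1)%R -> th2 j u = 0%R) ->
  \int[muQ m]_y (g y * tensor th2 y)%:E = \int[muQ m]_y (G e y * tensor th y)%:E.
Proof.
move=> sth th2E thM th2M th0 th20.
have sth2 j : smc (th2 j).
  by rewrite th2E; case: ifP => // _; do 2 apply: smc_derive1.
have mt : measurable_fun setT (tensor th : X -> R).
  by apply: measurable_tensor => i; exact: smc_continuous.
have mt2 : measurable_fun setT (tensor th2 : X -> R).
  by apply: measurable_tensor => i; exact: smc_continuous.
have ig := integrable_muQ m (mG finset.set0) (G2 finset.set0).
have iGe := integrable_muQ m (mG e) (G2 e).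
rewrite -(giint_muQ (mG finset.set0) ig mt2 (fun y => norm_tensor_le y th2M)
  (fun y => tensor_Q0 (y := y) th20)).
rewrite -(giint_muQ (mG e) iGe mt (fun y => norm_tensor_le y thM)
  (fun y => tensor_Q0 (y := y) th0)).
have tf : test_fun (tensor th).
  apply: (@tensor_test_fun _ _ _ (fun j => - (m ord0 j)%:~R)%R
    (fun j => - (m ord0 j)%:~R + 1)%R) => //.
  by move=> j u nu; apply: th0; apply: contra_not nu => /andP[/ltW -> /ltW ->].
have [_ /(_ e)[_ _ /(_ _ tf)]] := fG; rewrite /integral_d !iint_giint => <-.
rewrite pD_mixseq// (_ : tensor (fun j => _) = tensor th2); last first.
  by congr tensor; apply/funext => j; rewrite th2E.
apply: (@giint_ae_eq _ _ _ (@mDTP R) d _ _ _ 0 (measurable_neq_rV mf (mG finset.set0))) => //.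
- apply/measurable_EFinP; apply: measurable_funM => //; exact: mG.
- by apply/measurable_EFinP; exact: measurable_funM.
- by move=> y /= /negP; rewrite negbK => /eqP ->.
- exact: witness_ae_eq.
Qed.

Let bG m e : R := fine (\int[muQ m]_y `|G e y|%:E).

Lemma norm_integral_G_le m e (b : 'rV[R]_d -> R) (M : R) : measurable_fun setT (b : X -> R) ->
  (forall y, `|b y| <= M)%R ->
  `|\int[muQ m]_y (G e y * b y)%:E| <= (M * bG m e)%:E.
Proof.
move=> mb bM; have iGe := integrable_muQ m (mG e) (G2 e).
have M0 : (0 <= M)%R by apply: le_trans (bM 0%R); exact: normr_ge0.
have mG1 : measurable_fun setT (fun y : X => `|G e y|%:E).
  by apply/measurable_EFinP; apply: measurableT_comp => //; exact: mG.
have mGb : measurable_fun setT (fun y : X => (G e y * b y)%:E).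
  by apply/measurable_EFinP; apply: measurable_funM => //; exact: mG.
apply: (le_trans (le_abse_integral _ measurableT mGb)).
apply: (@le_trans _ _ (\int[muQ m]_y (M%:E * `|G e y|%:E))).
  apply: ge0_le_integral => //.
  - exact: measurableT_comp.
  - exact: measurable_funeM.
  - by move=> y _; rewrite abse_EFin -EFinM lee_fin normrM mulrC ler_wpM2r.
rewrite ge0_integralZl// EFinM /bG fineK//.
rewrite ge0_fin_numE; last by apply: integral_ge0 => y _; rewrite lee_fin.
by have /integrableP[_] := iGe.
Qed.

(** The bound is proved at each scale [s] and only then passed to the limit. After the transfer the
    undifferentiated functions remain, each bounded by [4]; the constants [C j], which depend on
    [k], provide integrability and domination only. *)
Lemma cube_estimate m k :
  ((weight R k) * fine `|\int[muQ m]_y (g y * Kc k m y)%:E|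
   <= 4 ^+ d * \sum_(e : {set 'I_d}) bG m e)%R.
Proof.
pose n (j : 'I_d) := `|k ord0 j|%N; pose a (j : 'I_d) : R := (- (m ord0 j)%:~R)%R.
pose tA s j : R -> R := thA2 (n j) (a j) s.
pose tQ s j : R -> R := thQ (n j) (a j) s.
have CP0 (j : 'I_d) := @thA2_bounded R (n j) (a j).
have [C CP] := boolp.choice CP0.
pose W s : 'rV[R]_d -> R := tensor (fun j u => tA s j u + tQ s j u)%R.
have mg := mG finset.set0.
have ig := integrable_muQ m (mG finset.set0) (G2 finset.set0).
have smA2 s j : smc (tA s j).
  by rewrite /tA -thA_derive2; do 2 apply: smc_derive1; exact: smc_thA.
have mW s : measurable_fun setT (W s : X -> R).
  apply: measurable_tensor => j; apply: smc_continuous.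
  by apply: smc_add; [exact: smA2|exact: smc_thQ].
have WM s : (0 <= s)%R -> forall y, (`|W s y| <= \prod_j (C j + 4))%R.
  move=> s0 y; apply: norm_tensor_le => j u; apply: (le_trans (ler_normD _ _)).
  by apply: lerD; [exact: (CP j).2|exact: thQ_le4].
have Wle s : (0 <= s)%R ->
    `|\int[muQ m]_y (g y * W s y)%:E| <= (4 ^+ d * \sum_(e : {set 'I_d}) bG m e)%:E.
  move=> s0.
  pose th e j : R -> R := if j \in e then thA (n j) (a j) s else thQ (n j) (a j) s.
  pose th2 e j : R -> R := if j \in e then tA s j else tQ s j.
  have WE y : W s y = (\sum_(e : {set 'I_d}) tensor (th2 e) y)%R.
    rewrite /W /tensor.
    apply: (etrans (bigA_distr 1%R +%R (fun j => tA s j (y ord0 j)) (fun j => tQ s j (y ord0 j)))).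
    apply: eq_big => // e _.
    by apply: eq_bigr => j _; rewrite /th2; case: ifP.
  have sth2 e j : smc (th2 e j).
    by rewrite /th2; case: ifP => _; [exact: smA2|exact: smc_thQ].
  have th2M e j u : (`|th2 e j u| <= C j + 4)%R.
    have [C0 CA] := CP j; rewrite /th2; case: ifP => _.
      by apply: (le_trans (CA _ _ s0)); rewrite lerDl.
    by apply: (le_trans (thQ_le4 _ _ _ _)); rewrite lerDr.
  have mth2 e : measurable_fun setT (tensor (th2 e) : X -> R).
    by apply: measurable_tensor => j; exact: smc_continuous.
  have ige e : (muQ m).-integrable setT (fun y : X => (g y * tensor (th2 e) y)%:E).
    exact: (integrable_bounded_mul (mth2 e) (fun y => norm_tensor_le y (th2M e)) ig).
  have -> : \int[muQ m]_y (g y * W s y)%:E =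
      \sum_(e : {set 'I_d}) \int[muQ m]_y (g y * tensor (th2 e) y)%:E.
    rewrite -integral_sum//; apply: eq_integral => y _.
    by rewrite sumEFin WE mulr_sumr.
  apply: (le_trans (lee_abs_sum _ _ _)); rewrite mulr_sumr -sumEFin; apply: lee_sum => e _.
  have smth j : smc (th e j).
    by rewrite /th; case: ifP => _; [exact: smc_thA|exact: smc_thQ].
  have thM j u : (`|th e j u| <= 4)%R.
    by rewrite /th; case: ifP => _; [exact: thA_le4|exact: thQ_le4].
  rewrite (@weak_transfer e m (th e) (th2 e) (fun=> 4%R) (fun j => C j + 4)%R)//.
  - rewrite (_ : 4 ^+ d = \prod_(j < d) 4 :> R)%R; last by rewrite prodr_const card_ord.
    apply: norm_integral_G_le; last by move=> y; exact: norm_tensor_le.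
    by apply: measurable_tensor => j; exact: smc_continuous.
  - by move=> j; rewrite /th2 /th; case: ifP => // _; rewrite thA_derive2.
  - by move=> j u nu; rewrite /th; case: ifP => _; [exact: thA_eq0|exact: thQ_eq0].
  - by move=> j u nu; rewrite /th2; case: ifP => _; [exact: thA2_eq0|exact: thQ_eq0].
have igQ : mu.-integrable (Q m) (fun y : X => (g y)%:E).
  have /integrableP[mg' gfin] := ig; apply/integrableP; split; first exact: measurable_funTS.
  rewrite -ge0_integral_muQ//; exact: measurableT_comp.
have lim : \int[muQ m]_y (g y * W i.+1%:R y)%:E @[i --> \oo] -->
    \int[muQ m]_y (g y * (weight R k * Kc k m y))%:E.
  have mgK : measurable_fun setT (fun y : X => (g y * (weight R k * Kc k m y))%:E).
    apply/measurable_EFinP; apply: measurable_funM => //.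
    by apply: measurable_funM => //; exact: measurable_Kc.
  have mgW s : measurable_fun setT (fun y : X => (g y * W s y)%:E).
    by apply/measurable_EFinP; exact: measurable_funM.
  rewrite integral_muQ//.
  rewrite (_ : (fun i => \int[muQ m]_y (g y * W i.+1%:R y)%:E) =
    (fun i : nat => \int[mu]_(y in Q m) (g y * W i.+1%:R y)%:E)); last first.
    by apply/funext => i; rewrite integral_muQ.
  have [] := @dominated_convergence _ X R mu (Q m) (measurable_Q m)
    (fun i y => (g y * W i.+1%:R y)%:E) (fun y => (g y * (weight R k * Kc k m y))%:E)
    (fun y => (\prod_j (C j + 4))%R%:E * `|(g y)%:E|).
  - by move=> i; exact: measurable_funTS.
  - exact: measurable_funTS.
  - apply: aeW => y /Q_mem Qy; apply: cvg_EFin; first exact: nearW.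
    apply: cvgMr; rewrite /W /tensor.
    (* In each factor [kA2 + kQ] is the rescaled cosine, so the weighted kernel is the product of
       the pointwise limits. *)
    rewrite (_ : (weight R k * Kc k m y)%R =
      (\prod_j (kA2 (n j) (y ord0 j - a j) + kQ (n j) (y ord0 j - a j)))%R); last first.
      rewrite /weight /Kc -big_split/=; apply: eq_bigr => j _; rewrite kA2DkQ /n /a opprK.
      by rewrite natr_absz intr_norm.
    elim: (index_enum _) => [|j r IH].
      rewrite big_nil (_ : (fun i => _) = cst 1%R); first exact: cvg_cst.
      by apply/funext => i; rewrite /= big_nil.
    rewrite big_cons (_ : (fun i => _) = (fun i : nat =>
      (tA i.+1%:R j (y ord0 j) + tQ i.+1%:R j (y ord0 j)) *
      \prod_(j <- r) (tA i.+1%:R j (y ord0 j) + tQ i.+1%:R j (y ord0 j)))%R); last first.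
      by apply/funext => i; rewrite /= big_cons.
    have cA : tA i.+1%:R j (y ord0 j) @[i --> \oo] --> kA2 (n j) (y ord0 j - a j).
      by apply: thA2_cvg; exact: (Qy j).
    have cQ : tQ i.+1%:R j (y ord0 j) @[i --> \oo] --> kQ (n j) (y ord0 j - a j).
      by apply: thQ_cvg; exact: (Qy j).
    exact: (cvgM (cvgD cA cQ) IH).
  - by apply: integrableZl => //; [exact: measurable_Q|exact: integrable_abse].
  - apply: aeW => y i _; rewrite !abse_EFin -EFinM lee_fin normrM mulrC ler_wpM2r//.
    exact: WM.
  - by [].
have iK : (muQ m).-integrable setT (fun y : X => (g y * Kc k m y)%:E).
  exact: (integrable_bounded_mul (measurable_Kc k m) (Kc_le1 k m) ig).
have finK : \int[muQ m]_y (g y * Kc k m y)%:E \is a fin_num by exact: integrable_fin_num.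
have w0 : (0 <= weight R k)%R by apply: prodr_ge0 => i _; exact: sqr_ge0.
have limE : \int[muQ m]_y (g y * (weight R k * Kc k m y))%:E =
    (weight R k)%:E * \int[muQ m]_y (g y * Kc k m y)%:E.
  rewrite -integralZl//; apply: eq_integral => y _.
  by rewrite -EFinM mulrCA.
have : `|(weight R k)%:E * \int[muQ m]_y (g y * Kc k m y)%:E| <=
    (4 ^+ d * \sum_(e : {set 'I_d}) bG m e)%:E.
  have la : `|\int[muQ m]_y (g y * W i.+1%:R y)%:E| @[i --> \oo] -->
      `|\int[muQ m]_y (g y * (weight R k * Kc k m y))%:E| by exact: cvg_abse.
  rewrite -limE; apply: cvge_le la.
  by apply: nearW => i; exact: Wle.
by rewrite abseM abse_EFin (ger0_norm w0) -(fineK finK) abse_EFin -EFinM lee_fin.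
Qed.

Lemma cube_estimate_sqr m k :
  (weight R k ^+ 2 * fine (\int[muQ m]_y (g y * Kc k m y)%:E) ^+ 2
   <= (8 ^+ d) ^+ 2 * \sum_(e : {set 'I_d}) fine (\int[muQ m]_y (G e y ^+ 2)%:E))%R.
Proof.
set J := (\sum_(e : {set 'I_d}) fine (\int[muQ m]_y (G e y ^+ 2)%:E))%R.
have J0 : (0 <= J)%R.
  by apply: sumr_ge0 => e _; apply: fine_ge0; apply: integral_ge0 => y _; rewrite lee_fin sqr_ge0.
have bJ e : (bG m e <= Num.sqrt J)%R.
  have b0 : (0 <= bG m e)%R by apply: fine_ge0; apply: integral_ge0 => y _; rewrite lee_fin.
  rewrite -(ger0_norm b0) -sqrtr_sqr ler_sqrt// (le_trans (norm_integral_muQ_le m (mG e) (G2 e)))//.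
  rewrite /J (bigD1 e)//= lerDl; apply: sumr_ge0 => e' _; apply: fine_ge0.
  by apply: integral_ge0 => y _; rewrite lee_fin sqr_ge0.
have w0 : (0 <= weight R k)%R by apply: prodr_ge0 => i _; exact: sqr_ge0.
have H : (weight R k * fine `|\int[muQ m]_y (g y * Kc k m y)%:E| <= 8 ^+ d * Num.sqrt J)%R.
  apply: (le_trans (cube_estimate m k)).
  (* There are [2 ^+ d] subsets, each contributing at most [Num.sqrt J]; together with [4 ^+ d] this
     makes [8 ^+ d]. *)
  apply: (@le_trans _ _ (4 ^+ d * (2 ^+ d * Num.sqrt J))%R).
    rewrite ler_wpM2l ?exprn_ge0//; apply: (le_trans (ler_sum _ (fun e _ => bJ e))).
    rewrite sumr_const -cardsT -powersetT card_powerset cardsT card_ord.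
    by rewrite -[leLHS]mulr_natl natrX.
  by rewrite mulrA -exprMn -natrM.
have iK : (muQ m).-integrable setT (fun y : X => (g y * Kc k m y)%:E).
  apply: (integrable_bounded_mul (measurable_Kc k m) (Kc_le1 k m)).
  exact: (integrable_muQ m (mG finset.set0) (G2 finset.set0)).
have finK : \int[muQ m]_y (g y * Kc k m y)%:E \is a fin_num by exact: integrable_fin_num.
have H2 : ((weight R k * fine `|\int[muQ m]_y (g y * Kc k m y)%:E|) ^+ 2 <=
    (8 ^+ d * Num.sqrt J) ^+ 2)%R.
  rewrite lerXn2r// nnegrE; first by rewrite mulr_ge0// fine_ge0// abse_ge0.
  by rewrite mulr_ge0 ?exprn_ge0 ?sqrtr_ge0.
by move: H2; rewrite !exprMn (sqr_sqrtr J0) fine_abse// real_normK ?num_real.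
Qed.

Lemma lhs_sup_le : lhs_sup f <= (8 ^+ d * H2mix_norm G)%:E.
Proof.
apply: ub_ereal_sup => _ [k _ <-].
have w0 : (0 < weight R k)%R.
  by apply: prodr_gt0 => i _; rewrite exprn_gt0// ltr_pwDl// ler0z.
pose N := H2mix_norm G.
have N2 : (N ^+ 2 = \sum_(e : {set 'I_d}) fine (L2sq (G e)))%R.
  rewrite /N /H2mix_norm sqr_sqrtr//; apply: sumr_ge0 => e _; apply: fine_ge0.
  by rewrite L2sqE//; apply: integral_ge0 => y _; rewrite lee_fin sqr_ge0.
(* The bound required of the square root of the sum once the positive weight is divided out. *)
pose c := (8 ^+ d * N / weight R k)%R.
have c0 : (0 <= c)%R by rewrite divr_ge0 ?(ltW w0)// mulr_ge0 ?exprn_ge0// sqrtr_ge0.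
suff S : \esum_(m in [set: 'rV[int]_d]) fourier_abs2 (tent_shift f m) k <= (c ^+ 2)%:E.
  apply: (@le_trans _ _ ((weight R k)%:E * sqrte (c ^+ 2)%:E)).
    by rewrite lee_wpmul2l ?lee_fin ?(ltW w0)// lee_sqrt// lee_fin sqr_ge0.
  rewrite /= sqrtr_sqr (ger0_norm c0) -EFinM lee_fin /c mulrC divfK// gt_eqF//.
(* The sum over all translates is a supremum of finite sums, so finitely many cubes are treated at a
   time. *)
apply: ub_ereal_sup => _ [A [fA _] <-]; rewrite fsbig_finite//=.
have ig m := integrable_muQ m (mG finset.set0) (G2 finset.set0).
have finK m : \int[muQ m]_y (g y * Kc k m y)%:E \is a fin_num.
  apply: integrable_fin_num => //.
  exact: (integrable_bounded_mul (measurable_Kc k m) (Kc_le1 k m) (ig m)).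
rewrite (eq_bigr (fun m => (fine (\int[muQ m]_y (g y * Kc k m y)%:E) ^+ 2)%:E)); last first.
  move=> m _; rewrite (fourier_abs2_tent k mf (mG finset.set0) witness_ae_eq (ig m)).
  by rewrite -[in LHS](fineK (finK m)) -EFin_expe.
rewrite sumEFin lee_fin.
have -> : (c ^+ 2 = (8 ^+ d) ^+ 2 / weight R k ^+ 2 * N ^+ 2)%R.
  by rewrite /c !exprMn exprVn mulrAC.
apply: (@le_trans _ _ (\sum_(m <- finmap.enum_fset (fset_set A))
    ((8 ^+ d) ^+ 2 / weight R k ^+ 2 *
     \sum_(e : {set 'I_d}) fine (\int[muQ m]_y (G e y ^+ 2)%:E)))%R).
  apply: ler_sum => m _.
  by rewrite mulrAC ler_pdivlMr ?exprn_gt0// mulrC; exact: cube_estimate_sqr.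
(* With the sums exchanged, disjointness of the cubes applies to each [G e] separately. *)
rewrite -mulr_sumr ler_wpM2l ?divr_ge0 ?sqr_ge0// N2 exchange_big/=.
by apply: ler_sum => e _; apply: sum_muQ_sqr_le => //; exact: finmap.fset_uniq.
Qed.

End Estimate.
End Cubes.

Theorem theorem6p2 (R : realType) (d : nat) :
  exists C : R, 0 < C /\
    forall (f : 'rV[R]_d -> R) (G : {set 'I_d} -> 'rV[R]_d -> R),
      H2mix_witness f G ->
      (lhs_sup f <= (C * H2mix_norm G)%:E)%E.
Proof.
exists (8 ^+ d); split; first by rewrite exprn_gt0.
by move=> f G fG; exact: lhs_sup_le.
Qed.
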